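(* Let $\mathbb{K}=\mathbb{R}$ or $\mathbb{C}$ and let $A\in\mathbb{K}^{m\times n}$, $B\in\mathbb{K}^{n\times k}$ be two matrices of ranks $r_A$ and $r_B$. (I) The following conditions are equivalent: (1) $B^{+}A^{+}$ is a $\{1,2,3\}$-inverse of $AB$; (2) $\mathcal{C}(A^*AB)=\mathcal{C}(A^* )\cap\mathcal{C}(B)$; (3) $ABB^{+}A^{+}$ is an orthogonal projection; (4) $ABB^{+}A^{+}=AB(AB)^{+}$; (5) there exist singular value decompositions $A=U_A\Sigma_AV_A^*$, $B=U_B\Sigma_BV_B^*$ and an orthogonal (unitary, if $\mathbb{K}=\mathbb{C}$) matrix $Q\in\mathbb{K}^{r_B\times r_B}$ such that $V_A^*U_B=\begin{bmatrix}0&*\\ Q&0\\ 0&*\end{bmatrix}$, or $AB=0$; (6) $(BB^* )^{+}(A^*A)^{+}$ is a $\{1,2,3\}$-inverse of $A^*ABB^*$; (7) the principal angles between $\mathcal{C}(A^* )$ and $\mathcal{C}(B)$ belong to the set $\{0,\frac{\pi}{2}\}$ and $\mathcal{C}(A^* )\cap\mathcal{C}(B)$ is spanned by right singular vectors of $A$ (in some singular value decomposition of $A$). (II) The following conditions are equivalent: (1) $B^{+}A^{+}$ is a $\{1,2,4\}$-inverse of $AB$; (2) $\mathcal{C}(BB^*A^* )=\mathcal{C}(A^* )\cap\mathcal{C}(B)$; (3) $B^{+}A^{+}AB$ is an orthogonal projection; (4) $B^{+}A^{+}AB=(AB)^{+}AB$; (5) there exist singular value decompositions $A=U_A\Sigma_AV_A^*$,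 $B=U_B\Sigma_BV_B^*$ and an orthogonal (unitary, if $\mathbb{K}=\mathbb{C}$) matrix $Q\in\mathbb{K}^{r_A\times r_A}$ such that $V_A^*U_B=\begin{bmatrix}0&Q&0\\ *&0&*\end{bmatrix}$, or $AB=0$; (6) $(BB^* )^{+}(A^*A)^{+}$ is a $\{1,2,4\}$-inverse of $A^*ABB^*$; (7) the principal angles between $\mathcal{C}(A^* )$ and $\mathcal{C}(B)$ belong to the set $\{0,\frac{\pi}{2}\}$ and $\mathcal{C}(A^* )\cap\mathcal{C}(B)$ is spanned by left singular vectors of $B$ (in some singular value decomposition of $B$).
   Context: $M^*$ is the conjugate transpose, $M^{+}$ the Moore--Penrose pseudoinverse, and $\mathcal{C}(M)$ the column space of $M$. Consider the Penrose conditions for a pair $(M,X)$: (1) $MXM=M$; (2) $XMX=X$; (3) $(MX)^*=MX$; (4) $(XM)^*=XM$. $X$ is an $\{i,j,k\}$-inverse of $M$ if it satisfies conditions $i,j,k$. An orthogonal projection is a matrix $P$ with $P^2=P=P^*$. A singular value decomposition of $M\in\mathbb{K}^{p\times q}$ of rank $r$ is $M=U\Sigma V^*$ with $U\in\mathbb{K}^{p\times p}$, $V\in\mathbb{K}^{q\times q}$ unitary (orthogonal over $\mathbb{R}$) and $\Sigma=\operatorname{diag}(\sigma_1,\ldots,\sigma_r,0,\ldots,0)\in\mathbb{R}^{p\times q}$ with $\sigma_1\ge\sigma_2\ge\ldots\ge\sigma_r>0$; the first $r$ columns of $U$ (resp. $V$) are the left (resp. right) singular vectors of $M$. In the block matrices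 $*$ denotes an arbitrary block, and zero and $*$ blocks may be empty. If $U,V$ are matrices with $n$ rows and orthonormal columns, the cosines of the principal angles (in $[0,\frac{\pi}{2}]$) between $\mathcal{C}(U)$ and $\mathcal{C}(V)$ are the singular values (zeros included) of $V^*U$; if one subspace is zero there are no principal angles. The zero subspace is spanned by the empty set.
   Formalization: In condition (5) of (I) and (II) the positive singular values in the decompositions of A and B may come in any order (still before the zeros); with decreasing order (5) fails while (1) holds, e.g. A=diag(3,2,1), B=diag(1,0,1) for (I), and with A and B swapped for (II). *)

(* Defs.v *)
From HB Require Import structures.
From mathcomp Require Import all_boot all_order all_algebra.
From mathcomp Require Import complex.
From mathcomp Require Import all_classical all_reals all_analysis.

Set Implicit Arguments.
Unset Strict Implicit.
Unset Printing Implicit Defensive.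

Import Order.TTheory GRing.Theory Num.Theory.
Local Open Scope ring_scope.

Variant scalars := RealScalars | ComplexScalars.

Definition scalar_field (R : realType) (F : scalars) : numFieldType :=
  match F with
  | RealScalars => R
  | ComplexScalars => (R[i] : numFieldType)
  end.

Definition kconj (R : realType) (F : scalars) :
    scalar_field R F -> scalar_field R F :=
  match F with
  | RealScalars => id
  | ComplexScalars => @conjc R
  end.

Definition kreal (R : realType) (F : scalars) : R -> scalar_field R F :=
  match F with
  | RealScalars => id
  | ComplexScalars => real_complex R
  end.

Section Definitions.
Variables (R : realType) (F : scalars).
Local Notation K := (scalar_field R F).

Definition adj m n (M : 'M[K]_(m, n)) : 'M[K]_(n, m) :=
  map_mx (@kconj R F) M^T.

Definition penrose1 m n (M : 'M[K]_(m, n)) (X : 'M[K]_(n, m)) : Prop :=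
  M *m X *m M = M.
Definition penrose2 m n (M : 'M[K]_(m, n)) (X : 'M[K]_(n, m)) : Prop :=
  X *m M *m X = X.
Definition penrose3 m n (M : 'M[K]_(m, n)) (X : 'M[K]_(n, m)) : Prop :=
  adj (M *m X) = M *m X.
Definition penrose4 m n (M : 'M[K]_(m, n)) (X : 'M[K]_(n, m)) : Prop :=
  adj (X *m M) = X *m M.

Definition inverse123 m n (M : 'M[K]_(m, n)) (X : 'M[K]_(n, m)) : Prop :=
  [/\ penrose1 M X, penrose2 M X & penrose3 M X].
Definition inverse124 m n (M : 'M[K]_(m, n)) (X : 'M[K]_(n, m)) : Prop :=
  [/\ penrose1 M X, penrose2 M X & penrose4 M X].
Definition inverse1234 m n (M : 'M[K]_(m, n)) (X : 'M[K]_(n, m)) : Prop :=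
  [/\ penrose1 M X, penrose2 M X, penrose3 M X & penrose4 M X].

(* The default 0 is never used: see mpinvP and mpinv_uniq. *)
Definition mpinv m n (M : 'M[K]_(m, n)) : 'M[K]_(n, m) :=
  xget 0 [set X | inverse1234 M X]%classic.

(* MathComp's subspaces are row spaces, so the column space of M is encoded
   as the row space of its transpose (without conjugation). *)
Definition colspace m n (M : 'M[K]_(m, n)) : 'M[K]_m := << M^T >>%MS.

Definition orthogonal_projection n (P : 'M[K]_n) : Prop :=
  P *m P = P /\ adj P = P.

Definition orthonormal_cols n p (U : 'M[K]_(n, p)) : Prop :=
  adj U *m U = 1%:M.
Definition unitary n (U : 'M[K]_n) : Prop :=
  adj U *m U = 1%:M /\ U *m adj U = 1%:M.

(* s lists the nonzero singular values; past its end s`_i is 0. *)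
Definition sigma_mx p q (s : seq R) : 'M[R]_(p, q) :=
  \matrix_(i < p, j < q) (if i == j :> nat then s`_i else 0).

(* A singular value decomposition, except that the singular values may come
   in any order (the positive ones still precede the zeros). The block forms
   below need this freedom: for A = diag(3,2,1), B = diag(1,0,1) and decreasing
   singular values, the first two columns of V_A^* U_B are supported in rows 1
   and 3, which are not consecutive. *)
Definition unordered_svd p q (M : 'M[K]_(p, q))
    (U : 'M[K]_p) (s : seq R) (V : 'M[K]_q) : Prop :=
  [/\ unitary U, unitary V,
      M = U *m map_mx (@kreal R F) (sigma_mx p q s) *m adj V,
      size s = \rank M
    & all (fun x : R => 0 < x) s].

Definition svd p q (M : 'M[K]_(p, q))
    (U : 'M[K]_p) (s : seq R) (V : 'M[K]_q) : Prop :=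
  unordered_svd M U s V /\ sorted (fun x y : R => y <= x) s.

(* W is spanned by some (possibly none) of the first r columns of U. *)
Definition spanned_by_first_cols n (W : 'M[K]_n) (r : nat) (U : 'M[K]_n) :
    Prop :=
  exists2 J : {set 'I_n}, (forall j, j \in J -> (j < r)%N)
    & (W == \sum_(j in J) colspace (col j U))%MS.

Definition spanned_by_right_singular_vectors p q (M : 'M[K]_(p, q))
    (W : 'M[K]_q) : Prop :=
  exists U s V, svd M U s V /\ spanned_by_first_cols W (\rank M) V.
Definition spanned_by_left_singular_vectors p q (M : 'M[K]_(p, q))
    (W : 'M[K]_p) : Prop :=
  exists U s V, svd M U s V /\ spanned_by_first_cols W (\rank M) U.

(* theta is a principal angle between the column spaces of M and N. There are
   minn p q of them, none if one of the two spaces is zero. *)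
Definition principal_angle n m1 m2 (M : 'M[K]_(n, m1)) (N : 'M[K]_(n, m2))
    (theta : R) : Prop :=
  exists p q (U : 'M[K]_(n, p)) (V : 'M[K]_(n, q)),
    [/\ orthonormal_cols U, orthonormal_cols V,
        (colspace U == colspace M)%MS, (colspace V == colspace N)%MS
      & exists X s Y (i : nat),
          [/\ svd (adj V *m U) X s Y, (i < minn p q)%N,
              0 <= theta <= pi / 2 & cos theta = s`_i]].

Definition principal_angles_0_pi2 n m1 m2
    (M : 'M[K]_(n, m1)) (N : 'M[K]_(n, m2)) : Prop :=
  forall theta, principal_angle M N theta -> theta = 0 \/ theta = pi / 2.

(* W = [0 *; Q 0; 0 *], with blocks allowed to be empty. *)
Definition block_column_form n r (Q : 'M[K]_r) (W : 'M[K]_n) : Prop :=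
  exists p q c (X : 'M[K]_(p, c)) (Y : 'M[K]_(q, c))
      (hr : (p + (r + q))%N = n) (hc : (r + c)%N = n),
    W = castmx (hr, hc)
          (col_mx (row_mx 0 X) (col_mx (row_mx Q 0) (row_mx 0 Y))).

(* W = [0 Q 0; * 0 *], with blocks allowed to be empty. *)
Definition block_row_form n r (Q : 'M[K]_r) (W : 'M[K]_n) : Prop :=
  exists p q c (X : 'M[K]_(c, p)) (Y : 'M[K]_(c, q))
      (hr : (r + c)%N = n) (hc : (p + (r + q))%N = n),
    W = castmx (hr, hc)
          (col_mx (row_mx 0 (row_mx Q 0)) (row_mx X (row_mx 0 Y))).

Lemma kconj_is_additive : additive (@kconj R F).
Proof. by rewrite /kconj; case: F => // x y; exact: raddfB. Qed.
Lemma kconj_is_multiplicative : multiplicative (@kconj R F).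
Proof.
by rewrite /kconj; case: F; split => // [x y|];
  [exact: rmorphM | exact: rmorph1].
Qed.
HB.instance Definition _ :=
  GRing.isAdditive.Build K K (@kconj R F) kconj_is_additive.
HB.instance Definition _ :=
  GRing.isMultiplicative.Build K K (@kconj R F) kconj_is_multiplicative.

Lemma kconjK : involutive (@kconj R F).
Proof. by case: F => //= x; rewrite conjcK. Qed.

Lemma mul_kconj_ge0 (x : K) : 0 <= x * kconj x.
Proof.
case: F x => /= x; first by rewrite -expr2 sqr_ge0.
by rewrite -[conjc x]/(Num.conj x) mul_conjC_ge0.
Qed.

Lemma kconj_eq0 (x : K) : (kconj x == 0) = (x == 0).
Proof. by rewrite fmorph_eq0. Qed.

Lemma adjK m n (M : 'M[K]_(m, n)) : adj (adj M) = M.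
Proof. by apply/matrixP => i j; rewrite !mxE kconjK. Qed.

Lemma adjM m n p (M : 'M[K]_(m, n)) (N : 'M[K]_(n, p)) :
  adj (M *m N) = adj N *m adj M.
Proof. by rewrite /adj trmx_mul map_mxM. Qed.

Lemma adj_inv n (M : 'M[K]_n) : adj (invmx M) = invmx (adj M).
Proof. by rewrite /adj trmx_inv map_invmx. Qed.

Lemma mulmx_adj_eq0 m n (M : 'M[K]_(m, n)) : M *m adj M = 0 -> M = 0.
Proof.
move=> /matrixP H; apply/matrixP => i j; rewrite mxE.
have := H i i; rewrite !mxE => /eqP.
rewrite psumr_eq0 => [/allP/(_ j)|k _]; last by rewrite !mxE mul_kconj_ge0.
by rewrite mem_index_enum !mxE mulf_eq0 kconj_eq0 orbb => /(_ isT)/eqP.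
Qed.

Lemma gram_unit m n (M : 'M[K]_(m, n)) : row_free M -> M *m adj M \in unitmx.
Proof.
move=> fM; rewrite -row_free_unit -kermx_eq0; apply/eqP.
apply: (row_free_inj fM); rewrite mul0mx; apply: mulmx_adj_eq0.
by rewrite adjM mulmxA -(mulmxA _ M) mulmx_ker mul0mx.
Qed.

Lemma adj_row_free m n (M : 'M[K]_(m, n)) : row_free (adj M) = row_full M.
Proof. by rewrite /row_free /row_full /adj mxrank_map mxrank_tr. Qed.

Lemma mpinv_exists m n (M : 'M[K]_(m, n)) : exists X, inverse1234 M X.
Proof.
set G := row_base M; set C := col_base M.
have uG : G *m adj G \in unitmx by apply/gram_unit/row_base_free.
have uC : adj C *m C \in unitmx.
  rewrite -{2}[C]adjK; apply: gram_unit.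
  by rewrite adj_row_free col_base_full.
have := mulmx_base M; rewrite -/G -/C.
move: (\rank M) (G) (C) uG uC => r {}G {}C uG uC hM.
have MX : M *m (adj G *m invmx (G *m adj G) *m (invmx (adj C *m C) *m adj C))
    = C *m (invmx (adj C *m C) *m adj C).
  rewrite -[in LHS]hM -!mulmxA; congr (C *m _).
  by rewrite (mulmxA G) (mulmxA (G *m _)) mulmxV // mul1mx.
have XM : adj G *m invmx (G *m adj G) *m (invmx (adj C *m C) *m adj C) *m M
    = adj G *m invmx (G *m adj G) *m G.
  rewrite -[in LHS]hM -!mulmxA; congr (_ *m (_ *m _)).
  by rewrite (mulmxA (adj C)) mulmxA mulVmx // mul1mx.
exists (adj G *m invmx (G *m adj G) *m (invmx (adj C *m C) *m adj C)).
split; rewrite /penrose1 /penrose2 /penrose3 /penrose4 ?MX ?XM.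
- rewrite -[in LHS]hM -!mulmxA (mulmxA (adj C)).
  by rewrite (mulmxA (invmx _)) mulVmx // mul1mx.
- rewrite -!mulmxA; congr (_ *m _).
  by rewrite (mulmxA G) (mulmxA (G *m _)) mulmxV // mul1mx.
- by rewrite !adjM adj_inv !adjM !adjK mulmxA.
- by rewrite !adjM adj_inv !adjM !adjK mulmxA.
Qed.

Lemma mpinvP m n (M : 'M[K]_(m, n)) : inverse1234 M (mpinv M).
Proof. exact: (xgetPex 0 (mpinv_exists M)). Qed.

Lemma mpinv_uniq m n (M : 'M[K]_(m, n)) (X : 'M[K]_(n, m)) :
  inverse1234 M X -> X = mpinv M.
Proof.
move: (mpinvP M); set Y := mpinv M => -[y1 y2 y3 y4] [x1 x2 x3 x4].
have e1 : M *m X = M *m Y.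
  by rewrite -{1}x3 -{1}y1 -mulmxA adjM x3 y3 mulmxA x1.
have e2 : X *m M = Y *m M.
  by rewrite -{1}x4 -{1}y1 -(mulmxA M) mulmxA adjM x4 y4 -mulmxA (mulmxA M) x1.
by rewrite -x2 -mulmxA e1 mulmxA e2 y2.
Qed.

End Definitions.

(* Main.v *)
Require Import Defs.
From HB Require Import structures.
From mathcomp Require Import all_boot all_order all_fingroup all_algebra.
From mathcomp Require Import complex.
From mathcomp Require Import all_classical all_reals all_analysis.

Set Implicit Arguments.
Unset Strict Implicit.
Unset Printing Implicit Defensive.

Import Order.TTheory GRing.Theory Num.Theory.
Local Open Scope ring_scope.

(** Write P and Q for the orthogonal projections onto the column spaces of
    adj A and of B, and S for adj A *m A.  Every condition of the first list
    says that the column space of B is invariant under S; since S is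
    self-adjoint this means that Q commutes with S, which is the hub
    [gram_invariant], and each condition is shown equivalent to it.

    Suppose Q S = S Q.  As P is both S^+ S and S S^+, also P Q = Q P
    ([gram_invariant_commute]).  So P Q is the orthogonal projection onto the
    intersection of the two column spaces, S maps the column space of B onto
    that intersection, and the Penrose conditions for B^+ A^+ are short
    computations.  Conversely, if A Q A^+ is an orthogonal projection, then
    idempotence gives (P Q P)^2 = P Q P, which forces P and Q to commute
    ([orthogonal_projection_commute]), and self-adjointness then gives
    Q S = S Q ([projection_gram_invariant]).

    The condition on A'A and BB' (primes for adjoints) is the first one for
    that pair.  It therefore says that Q commutes with S^2, and Q then commutes
    with the positive semidefinite square root S of S^2; [commute_gram_sqr]
    proves this with a trace instead of the spectral theorem.

    The conditions on singular vectors need singular value decompositions.  A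
    compact one is built by splitting off one singular triple at a time
    ([csvd_exists]); triples come from eigenvectors of Gram matrices, whose
    existence over the reals is inherited from the complex numbers.  When
    Q S = S Q, the matrices A Q and A (1 - Q) have orthogonal row spaces and
    orthogonal column spaces, so decompositions of the two add up to one of A
    whose right singular vectors each lie in the column space of B or in its
    orthogonal complement.  Ordering them suitably makes those in the column
    space of B consecutive, which is the block form ([joint_svd]); keeping the
    singular values sorted gives the spanning condition.  Conversely, each of
    these two conditions makes a projection and S diagonal in one orthonormal
    basis.  The condition on principal angles is P Q = Q P, because the cosines
    are the singular values of the cross matrix of two orthonormal bases
    ([principal_angles_commute]).

    Taking adjoints turns the second list for (A, B) into the first list for
    (adj B, adj A). *)

(** * Scalars and eigenvectors of self-adjoint matrices *)

Section Scalars.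
Variables (R : realType) (F : scalars).
Local Notation K := (scalar_field R F).

Lemma kreal_is_zmod_morphism : zmod_morphism (@kreal R F).
Proof. by case: F => // x y; exact: raddfB. Qed.
Lemma kreal_is_monoid_morphism : monoid_morphism (@kreal R F).
Proof. by case: F; split => [|x y] /=; rewrite ?rmorph1 ?rmorphM. Qed.
HB.instance Definition _ :=
  GRing.isZmodMorphism.Build R K (@kreal R F) kreal_is_zmod_morphism.
HB.instance Definition _ :=
  GRing.isMonoidMorphism.Build R K (@kreal R F) kreal_is_monoid_morphism.

Lemma kconj_kreal (a : R) : kconj (kreal F a) = kreal F a.
Proof. by case: F => //=; exact: conjc_real. Qed.

Lemma kreal_ge0 (a : R) : (0 <= kreal F a) = (0 <= a).
Proof. by case: F => //=; rewrite lecR. Qed.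

Lemma ge0_kreal (x : K) : 0 <= x -> exists2 a : R, 0 <= a & x = kreal F a.
Proof.
case: F x => /= x x_ge0; first by exists x.
have /complex_realP[a xa] := ger0_real x_ge0.
by exists a; rewrite // -lecR -xa.
Qed.

(** The spectral theorem diagonalises H with real entries; they cannot all
    vanish unless H does. *)
Lemma complex_hermitian_eigenvalue n (H : 'M[R[i]]_n) :
  map_mx (@conjc R) H^T = H -> H != 0 ->
  exists2 a : R, a != 0 & root (char_poly H) a%:C%C.
Proof.
move=> hH nz.
have Hh : H \is hermsymmx.
  by apply/is_hermitianmxP; rewrite expr0 scale1r; exact/esym.
have Hd : H = invmx (spectralmx H) *m diag_mx (spectral_diag H) *m spectralmx H.
  exact/orthomx_spectralP/hermitian_normalmx.
have [i di] : exists i, spectral_diag H 0 i != 0.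
  apply/existsP; apply: contraNT nz; rewrite negb_exists => /forallP h.
  have -> : H = 0.
    rewrite Hd (_ : diag_mx _ = 0) ?mulmx0 ?mul0mx//.
    apply/matrixP => i j; rewrite !mxE.
    by have /negPn/eqP -> := h i; rewrite mul0rn.
  by [].
have := hermitian_spectral_diag_real Hh => /mxOverP /(_ 0 i).
case/complex_realP => a ea; exists a.
  by apply: contraNneq di => a0; rewrite ea a0.
rewrite -eigenvalue_root_char -ea; apply/eigenvalueP.
exists (row i (spectralmx H)).
  rewrite -row_mul {2}Hd !mulmxA mulmxV ?spectral_unit// mul1mx.
  by rewrite row_mul row_diag_mx -scalemxAl -rowE.
have := spectral_unit H; rewrite -row_free_unit => fS.
apply/eqP => r0; have := row_free_inj fS.
move=> /(_ 1%N (delta_mx 0 i) 0); rewrite mul0mx -rowE => /(_ r0).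
by move=> /matrixP /(_ 0 i); rewrite !mxE !eqxx => /eqP; rewrite oner_eq0.
Qed.

(** Over the reals the eigenvalue is found in the complexification: it is
    real because H is self-adjoint, so it is a root of the characteristic
    polynomial already over the reals. *)
Lemma hermitian_eigenvector n (H : 'M[K]_n) : adj H = H -> H != 0 ->
  exists (a : R) (v : 'rV[K]_n),
    [/\ a != 0, v != 0 & v *m H = kreal F a *: v].
Proof.
move=> hH nz.
suff [a a0 ra] : exists2 a : R, a != 0 & root (char_poly H) (kreal F a).
  move: ra; rewrite -eigenvalue_root_char => /eigenvalueP[v vH v0].
  by exists a, v.
case: F H hH nz => /= H hH nz; last exact: complex_hermitian_eigenvalue.
pose Hc := map_mx (real_complex R) H.
have hc : map_mx (@conjc R) Hc^T = Hc.
  apply/matrixP => i j; rewrite !mxE conjc_real.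
  by move/matrixP/(_ i j): hH; rewrite !mxE => hji; congr (_%:C)%C.
have nzc : Hc != 0 by rewrite map_mx_eq0.
have [a a0 ra] := complex_hermitian_eigenvalue hc nzc.
by exists a => //; move: ra; rewrite -map_char_poly fmorph_root.
Qed.

End Scalars.

(** * Orthogonal projections onto column spaces *)

Section Projections.
Variables (R : realType) (F : scalars).
Local Notation K := (scalar_field R F).

Lemma adjmxB m n (M N : 'M[K]_(m, n)) : adj (M - N) = adj M - adj N.
Proof. by rewrite /adj linearB map_mxB. Qed.

Lemma adjmx0 m n : adj (0 : 'M[K]_(m, n)) = 0.
Proof. by rewrite /adj trmx0 map_mx0. Qed.

Lemma adjmx1 n : adj (1%:M : 'M[K]_n) = 1%:M.
Proof. by rewrite /adj trmx1 map_mx1. Qed.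

Lemma adjmx_inj m n : injective (@adj R F m n).
Proof. exact: can_inj (@adjK R F m n). Qed.

Lemma adjmxZ m n (a : K) (M : 'M[K]_(m, n)) : adj (a *: M) = kconj a *: adj M.
Proof. by apply/matrixP => i j; rewrite !mxE rmorphM. Qed.

Lemma adj_row_mx m n1 n2 (M : 'M[K]_(m, n1)) (N : 'M[K]_(m, n2)) :
  adj (row_mx M N) = col_mx (adj M) (adj N).
Proof. by rewrite /adj tr_row_mx map_col_mx. Qed.

Lemma adj_col_mx m1 m2 n (M : 'M[K]_(m1, n)) (N : 'M[K]_(m2, n)) :
  adj (col_mx M N) = row_mx (adj M) (adj N).
Proof. by rewrite /adj tr_col_mx map_row_mx. Qed.

Lemma mulmx_mpinvK m n (M : 'M[K]_(m, n)) : M *m mpinv M *m M = M.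
Proof. by case: (mpinvP M). Qed.

Lemma mpinv_mulmxK m n (M : 'M[K]_(m, n)) : mpinv M *m M *m mpinv M = mpinv M.
Proof. by case: (mpinvP M). Qed.

Lemma mpinv_adj m n (M : 'M[K]_(m, n)) : mpinv (adj M) = adj (mpinv M).
Proof.
case: (mpinvP M) => p1 p2 p3 p4; apply/esym/mpinv_uniq; split.
- by rewrite /penrose1 -!adjM mulmxA p1.
- by rewrite /penrose2 -!adjM mulmxA p2.
- by rewrite /penrose3 -adjM p4.
- by rewrite /penrose4 -adjM p3.
Qed.

(** Locked because [adj] of a visible product would be expanded by [adjM]. *)
Definition cproj m n (M : 'M[K]_(m, n)) : 'M[K]_m := locked (M *m mpinv M).

Lemma cprojE m n (M : 'M[K]_(m, n)) : cproj M = M *m mpinv M.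
Proof. by rewrite /cproj -lock. Qed.

Lemma adj_cproj m n (M : 'M[K]_(m, n)) : adj (cproj M) = cproj M.
Proof. by rewrite cprojE; case: (mpinvP M). Qed.

Lemma cproj_idem m n (M : 'M[K]_(m, n)) : cproj M *m cproj M = cproj M.
Proof. by rewrite cprojE mulmxA mulmx_mpinvK. Qed.

Lemma cproj_mul m n (M : 'M[K]_(m, n)) : cproj M *m M = M.
Proof. by rewrite cprojE mulmx_mpinvK. Qed.

Lemma adj_mul_cproj m n (M : 'M[K]_(m, n)) : adj M *m cproj M = adj M.
Proof. by rewrite -[in LHS](adj_cproj M) -adjM cproj_mul. Qed.

Lemma mpinv_mul_cproj m n (M : 'M[K]_(m, n)) : mpinv M *m cproj M = mpinv M.
Proof. by rewrite cprojE mulmxA mpinv_mulmxK. Qed.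

Lemma cproj_adj m n (M : 'M[K]_(m, n)) : cproj (adj M) = mpinv M *m M.
Proof. by rewrite -adj_cproj cprojE mpinv_adj adjM !adjK. Qed.

Lemma cproj_adj_mpinv m n (M : 'M[K]_(m, n)) :
  cproj (adj M) *m mpinv M = mpinv M.
Proof. by rewrite cproj_adj mpinv_mulmxK. Qed.

Lemma mul_cproj_adj m n (M : 'M[K]_(m, n)) : M *m cproj (adj M) = M.
Proof. by rewrite cproj_adj mulmxA mulmx_mpinvK. Qed.

Lemma orthogonal_projection_cproj m n (M : 'M[K]_(m, n)) :
  orthogonal_projection (cproj M).
Proof. by split; [exact: cproj_idem | exact: adj_cproj]. Qed.

Lemma orthogonal_projection_compl n (P : 'M[K]_n) :
  orthogonal_projection P -> orthogonal_projection (1%:M - P).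
Proof.
move=> [PP aP]; split; last by rewrite adjmxB adjmx1 aP.
by rewrite mulmxBl mul1mx mulmxBr mulmx1 PP subrr subr0.
Qed.

(** The hypotheses say that P and M have the same column space; two
    self-adjoint idempotents that absorb each other are equal. *)
Lemma cproj_uniq m n (M : 'M[K]_(m, n)) (P : 'M[K]_m) (X : 'M[K]_(n, m)) :
  orthogonal_projection P -> P *m M = M -> P = M *m X -> P = cproj M.
Proof.
move=> [_ aP] PM PX.
have e1 : cproj M *m P = P by rewrite PX mulmxA cproj_mul.
have e2 : P *m cproj M = cproj M by rewrite cprojE mulmxA PM.
by rewrite -aP -e1 adjM adj_cproj aP e2.
Qed.

Lemma cproj_id n (P : 'M[K]_n) : orthogonal_projection P -> cproj P = P.
Proof.
move=> hP; apply/esym; apply: (cproj_uniq (X := 1%:M) hP); last by rewrite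
  mulmx1.
by case: hP.
Qed.

Lemma cproj_gram m n (M : 'M[K]_(m, n)) : cproj (M *m adj M) = cproj M.
Proof.
apply/esym; apply: (cproj_uniq (X := adj (mpinv M) *m mpinv M)).
- exact: orthogonal_projection_cproj.
- by rewrite mulmxA cproj_mul.
- rewrite [LHS]cprojE -!mulmxA (mulmxA (adj M)) -adjM -cproj_adj adj_cproj.
  by rewrite cproj_adj_mpinv.
Qed.

(** [colspace] is a row space after transposition; this lemma and the next two
    turn its inclusions and equalities into identities between projections. *)
Lemma submx_colspaceP p m n (W : 'M[K]_(p, m)) (N : 'M[K]_(m, n)) :
  (W <= colspace N)%MS <-> cproj N *m W^T = W^T.
Proof.
rewrite /colspace genmxE; split.
  by case/submxP => D ->; rewrite trmx_mul trmxK mulmxA cproj_mul.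
move=> h; rewrite -[W]trmxK -h cprojE -mulmxA trmx_mul; exact: submxMl.
Qed.

Lemma colspace_subP p m n (M : 'M[K]_(m, p)) (N : 'M[K]_(m, n)) :
  (colspace M <= colspace N)%MS <-> cproj N *m M = M.
Proof. by rewrite {1}/colspace genmxE submx_colspaceP trmxK. Qed.

Lemma colspace_mull m n p (M : 'M[K]_(m, n)) (X : 'M[K]_(n, p)) :
  (colspace (M *m X) <= colspace M)%MS.
Proof. by apply/colspace_subP; rewrite mulmxA cproj_mul. Qed.

Lemma colspace_eqP p m n (M : 'M[K]_(m, p)) (N : 'M[K]_(m, n)) :
  (colspace M == colspace N)%MS <-> cproj M = cproj N.
Proof.
split=> [/andP[/colspace_subP h1 /colspace_subP h2]|h].
  have e1 : cproj N *m cproj M = cproj M.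
    by rewrite [in X in _ *m X]cprojE mulmxA h1 -cprojE.
  have e2 : cproj M *m cproj N = cproj N.
    by rewrite [in X in _ *m X]cprojE mulmxA h2 -cprojE.
  by rewrite -(adj_cproj M) -e1 adjM !adj_cproj e2.
by apply/andP; split; apply/colspace_subP; rewrite (h, esym h) cproj_mul.
Qed.

(** With Z = Q P - P Q P, the hypothesis is exactly that adj Z *m Z vanishes.
    Hence Q P = P Q P, and the right-hand side is self-adjoint. *)
Lemma orthogonal_projection_commute n (P Q : 'M[K]_n) :
  orthogonal_projection P -> orthogonal_projection Q ->
  P *m Q *m P *m Q *m P = P *m Q *m P -> P *m Q = Q *m P.
Proof.
move=> [PP aP] [QQ aQ] h.
have QQr (X : 'M[K]_n) : X *m Q *m Q = X *m Q by rewrite -mulmxA QQ.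
have PPr (X : 'M[K]_n) : X *m P *m P = X *m P by rewrite -mulmxA PP.
have /adjmx_inj e : adj (Q *m P - P *m Q *m P) = adj 0.
  rewrite adjmx0; apply: mulmx_adj_eq0.
  rewrite adjK adjmxB !adjM aP aQ mulmxBl !mulmxBr !mulmxA !QQr !PPr h.
  by rewrite subrr.
move/eqP: e; rewrite subr_eq0 => /eqP e.
by rewrite -[LHS]adjK adjM aP aQ e !adjM aP aQ mulmxA.
Qed.

Lemma orthogonal_projectionM n (P Q : 'M[K]_n) :
  orthogonal_projection P -> orthogonal_projection Q ->
  P *m Q = Q *m P -> orthogonal_projection (P *m Q).
Proof.
move=> [PP aP] [QQ aQ] h; split; last by rewrite adjM aP aQ h.
by rewrite {2}h mulmxA -(mulmxA P) QQ -mulmxA -h mulmxA PP.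
Qed.

Lemma colspace_cap m p q (M : 'M[K]_(m, p)) (N : 'M[K]_(m, q)) :
  cproj M *m cproj N = cproj N *m cproj M ->
  (colspace (cproj M *m cproj N) == colspace M :&: colspace N)%MS.
Proof.
move=> h; rewrite sub_capmx; apply/andP; split; first (apply/andP; split).
- by apply/colspace_subP; rewrite mulmxA cproj_idem.
- by apply/colspace_subP; rewrite h mulmxA cproj_idem.
have /submx_colspaceP hM := capmxSl (colspace M) (colspace N).
have /submx_colspaceP hN := capmxSr (colspace M) (colspace N).
apply/submx_colspaceP; rewrite cproj_id; first by rewrite -mulmxA hN hM.
by apply: orthogonal_projectionM => //; exact: orthogonal_projection_cproj.
Qed.

Lemma mxtrace_gram m n (M : 'M[K]_(m, n)) :
  \tr (M *m adj M) = \sum_i \sum_j M i j * kconj (M i j).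
Proof.
by apply: eq_bigr => i _; rewrite !mxE; apply: eq_bigr => j _; rewrite !mxE.
Qed.

Lemma mxtrace_gram_eq0 m n (M : 'M[K]_(m, n)) : \tr (M *m adj M) = 0 -> M = 0.
Proof.
rewrite mxtrace_gram => /eqP.
rewrite psumr_eq0 => [/allP h|i _]; last first.
  by apply: sumr_ge0 => j _; exact: mul_kconj_ge0.
apply/matrixP => i j; rewrite mxE.
have := h i; rewrite mem_index_enum => /(_ isT) /=.
rewrite psumr_eq0 => [/allP /(_ j)|? _]; last exact: mul_kconj_ge0.
by rewrite mem_index_enum mulf_eq0 kconj_eq0 orbb => /(_ isT)/eqP.
Qed.

(** Let Y = S P - P S.  It is skew-adjoint and, as S^2 commutes with P, it
    anticommutes with S.  So the trace of S Y^2 is its own opposite; up to sign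
    it is the squared Hilbert-Schmidt norm of M Y, which gives M Y = 0 and then
    Y^2 = 0, hence Y = 0. *)
Lemma commute_gram_sqr m n (M : 'M[K]_(m, n)) (P : 'M[K]_n) :
  let S := adj M *m M in
  orthogonal_projection P -> P *m (S *m S) = S *m S *m P -> P *m S = S *m P.
Proof.
move=> S; have eS : adj M *m M = S by []; clearbody S.
move=> [PP aP]; rewrite mulmxA => h; pose Y := S *m P - P *m S.
have aS : adj S = S by rewrite -eS adjM adjK.
have aY : adj Y = - Y by rewrite adjmxB (adjM S) (adjM P) aP aS opprB.
have SY : S *m Y = - (Y *m S).
  by rewrite mulmxBr mulmxBl !mulmxA opprB h.
have MY0 : M *m Y = 0.
  (* The trace to be shown zero is - \tr (S *m Y *m Y). *)
  apply: mxtrace_gram_eq0.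
  rewrite adjM aY mulmxA mxtrace_mulC mulmxN mulmxN !mulmxA eS.
  have t0 : \tr (S *m Y *m Y) = - \tr (S *m Y *m Y).
    rewrite {1}SY mulNmx raddfN /= -mulmxA; congr (- _).
    by rewrite mxtrace_mulC [RHS]mxtrace_mulC mulmxA.
  move/eqP: t0; rewrite -addr_eq0 -mulr2n mulrn_eq0 /= => /eqP t0.
  by rewrite raddfN /= t0 oppr0.
have SY0 : S *m Y = 0 by rewrite -eS -mulmxA MY0 mulmx0.
suff Y0 : Y = 0 by apply/esym/eqP; rewrite -subr_eq0 -/Y Y0.
apply: mulmx_adj_eq0; rewrite aY mulmxN; apply/eqP; rewrite oppr_eq0; apply/eqP.
rewrite {1}/Y mulmxBl -(mulmxA P) SY0 mulmx0 subr0 /Y mulmxBr !mulmxA.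
move/eqP: SY0; rewrite mulmxBr subr_eq0 !mulmxA => /eqP SSP.
by rewrite -SSP -!(mulmxA _ P P) PP SSP subrr.
Qed.

End Projections.

(** * The reverse order law as invariance under the Gram matrix *)

Section ReverseOrder.
Variables (R : realType) (F : scalars).
Local Notation K := (scalar_field R F).

(** As adj A *m A is self-adjoint, commuting with the projection onto the column
    space of B means leaving that column space invariant. *)
Definition gram_invariant m n k (A : 'M[K]_(m, n)) (B : 'M[K]_(n, k)) : Prop :=
  cproj B *m (adj A *m A) = adj A *m A *m cproj B.

(** The projection onto the column space of adj A is S^+ S with
    S = adj A *m A.  Moving the second projection through S gives
    P Q = P Q P, which is self-adjoint. *)
Lemma gram_invariant_commute m n k (A : 'M[K]_(m, n)) (B : 'M[K]_(n, k)) :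
  gram_invariant A B ->
  cproj (adj A) *m cproj B = cproj B *m cproj (adj A).
Proof.
move=> h; pose S := adj A *m A.
have PA_S : cproj (adj A) = mpinv S *m S.
  by rewrite -cproj_adj /S adjM adjK -{3}[A]adjK cproj_gram.
have S_PA : S *m cproj (adj A) = S by rewrite -mulmxA mul_cproj_adj.
have e : cproj (adj A) *m cproj B =
    cproj (adj A) *m cproj B *m cproj (adj A).
  by rewrite {1 2}PA_S -!(mulmxA (mpinv S)) -h -mulmxA S_PA.
by have := congr1 (@adj R F n n) e; rewrite !adjM !adj_cproj mulmxA -e.
Qed.

Lemma inverse123_projection m n (M : 'M[K]_(m, n)) (X : 'M[K]_(n, m)) :
  inverse123 M X -> orthogonal_projection (M *m X).
Proof. by case=> p1 _ p3; split => //; rewrite mulmxA p1. Qed.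

Lemma inverse123_mpinv m n (M : 'M[K]_(m, n)) (X : 'M[K]_(n, m)) :
  inverse123 M X -> M *m X = M *m mpinv M.
Proof.
move=> h; rewrite -cprojE.
by case: (h) => p1 _ _; exact: cproj_uniq (inverse123_projection h) p1 erefl.
Qed.

Section Pair.
Variables (m n k : nat) (A : 'M[K]_(m, n)) (B : 'M[K]_(n, k)).
Let PA := cproj (adj A).
Let PB := cproj B.

(** Write T = A Q A^+.  Multiplied by A^+ on the left and by A on the right,
    T^2 = T becomes (P Q P)^2 = P Q P, so P and Q commute.  Multiplied by
    adj A and A, self-adjointness of T becomes S Q P = P Q S; once P has been
    moved past Q, S absorbs it on both sides. *)
Lemma projection_gram_invariant :
  orthogonal_projection (A *m B *m mpinv B *m mpinv A) -> gram_invariant A B.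
Proof.
rewrite -(mulmxA A) -(cprojE B) -/PB => -[TT aT].
have APA : A *m PA = A by exact: mul_cproj_adj.
have PAE : PA = mpinv A *m A by exact: cproj_adj.
have comm : PA *m PB = PB *m PA.
  apply: orthogonal_projection_commute.
  - exact: orthogonal_projection_cproj.
  - exact: orthogonal_projection_cproj.
  move/(congr1 (fun X => mpinv A *m X *m A)): TT.
  by rewrite !mulmxA -PAE -!(mulmxA _ (mpinv A) A) -PAE.
have SP : adj A *m A *m PB *m PA = PA *m PB *m (adj A *m A).
  move/(congr1 (fun X => adj A *m X *m A)): aT.
  rewrite !adjM adj_cproj !mulmxA -adjM -PAE adj_cproj.
  by rewrite -!(mulmxA _ (mpinv A) A) -PAE => <-.
rewrite /gram_invariant -/PB.
have -> : PB *m (adj A *m A) = PB *m PA *m (adj A *m A).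
  by rewrite -(mulmxA PB) (mulmxA PA) cproj_mul.
by rewrite -comm -SP -!mulmxA -comm (mulmxA A PA) APA.
Qed.

Lemma gram_invariant_inverse123 :
  gram_invariant A B -> inverse123 (A *m B) (mpinv B *m mpinv A).
Proof.
move=> h; have comm := gram_invariant_commute h.
have PAE : PA = mpinv A *m A by exact: cproj_adj.
have ABBA : A *m B *m (mpinv B *m mpinv A) = A *m PB *m mpinv A.
  by rewrite /PB cprojE !mulmxA.
have APA : A *m PA = A by exact: mul_cproj_adj.
split; rewrite /penrose1 /penrose2 /penrose3 ?ABBA.
- rewrite -!mulmxA (mulmxA (mpinv A)) -PAE (mulmxA PB) -comm.
  by rewrite -(mulmxA PA) cproj_mul mulmxA APA.
- rewrite -!mulmxA (mulmxA B) -(cprojE B) -/PB (mulmxA (mpinv A)) -PAE.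
  by rewrite (mulmxA PA) comm -mulmxA cproj_adj_mpinv mulmxA mpinv_mul_cproj.
- rewrite !adjM adj_cproj mulmxA -/PB.
  (* Expanding adj A as S A^+ exposes Q S, which invariance turns into S Q. *)
  have e : adj A = adj A *m A *m mpinv A.
    by rewrite -mulmxA -(cprojE A) adj_mul_cproj.
  rewrite {1}e !mulmxA -(mulmxA _ (adj A)) -(mulmxA _ PB) h !mulmxA.
  rewrite -adjM -(cprojE A) adj_cproj.
  by rewrite cproj_mul.
Qed.

(** If the column space of S B lies in that of B, then Q S Q = S Q, and the
    left-hand side is self-adjoint.  In the other direction, P Q = Q S S^+ =
    S B (B^+ S^+) shows that S B reaches the whole intersection. *)
Lemma gram_invariant_colspace : gram_invariant A B <->
  (colspace (adj A *m A *m B) == colspace (adj A) :&: colspace B)%MS.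
Proof.
split=> [h|/andP[+ _]]; last first.
  rewrite sub_capmx => /andP[_ /colspace_subP SB].
  have e : PB *m (adj A *m A *m PB) = adj A *m A *m PB.
    have -> : adj A *m A *m PB = adj A *m A *m B *m mpinv B.
      by rewrite /PB cprojE mulmxA.
    by rewrite mulmxA SB.
  rewrite /gram_invariant -/PB -e.
  have := congr1 (@adj R F n n) e.
  by rewrite !adjM adjK adj_cproj -/PB -mulmxA.
have comm := gram_invariant_commute h.
apply/andP; split.
  rewrite sub_capmx; apply/andP; split; apply/colspace_subP.
    by rewrite !mulmxA cproj_mul.
  by rewrite mulmxA h -mulmxA cproj_mul.
rewrite -(eqmxP (colspace_cap comm)) comm.
have -> : cproj B *m cproj (adj A) =
    adj A *m A *m B *m (mpinv B *m mpinv (adj A *m A)).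
  rewrite mulmxA -(mulmxA _ B) -(cprojE B) -h -mulmxA -(cprojE (adj A *m A)).
  by rewrite -{3}[A]adjK cproj_gram.
exact: colspace_mull.
Qed.

End Pair.

(** The Gram matrix of adj A *m A is its square, and B *m adj B has the column
    space of B. *)
Lemma gram_invariant_gram m n k (A : 'M[K]_(m, n)) (B : 'M[K]_(n, k)) :
  gram_invariant (adj A *m A) (B *m adj B) <-> gram_invariant A B.
Proof.
rewrite /gram_invariant cproj_gram adjM adjK; split=> [|h].
  exact/commute_gram_sqr/orthogonal_projection_cproj.
by rewrite mulmxA h -mulmxA h mulmxA.
Qed.

End ReverseOrder.

(** * Compact singular value decompositions *)

Section CompactSVD.
Variables (R : realType) (F : scalars).
Local Notation K := (scalar_field R F).

Definition msigma p q (s : seq R) : 'M[K]_(p, q) :=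
  map_mx (@kreal R F) (sigma_mx p q s).

Lemma adj_msigma p q s : adj (msigma p q s) = msigma q p s.
Proof.
apply/matrixP => i j; rewrite !mxE kconj_kreal eq_sym.
by case: eqP => // ->.
Qed.

Definition kdiag r (s : seq R) : 'M[K]_r := msigma r r s.

Lemma kdiag_cat r1 r2 (s1 s2 : seq R) : size s1 = r1 ->
  kdiag (r1 + r2) (s1 ++ s2) = block_mx (kdiag r1 s1) 0 0 (kdiag r2 s2).
Proof.
move=> hs; apply/matrixP => i j; rewrite !mxE.
case: splitP => k ik; rewrite !mxE; case: splitP => l jl; rewrite !mxE ik jl.
- by rewrite nth_cat hs ltn_ord.
- by rewrite (ltn_eqF (ltn_addr l (ltn_ord k))) rmorph0.
- by rewrite eq_sym (ltn_eqF (ltn_addr k (ltn_ord l))) rmorph0.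
- by rewrite eqn_add2l nth_cat hs ltnNge leq_addr addKn.
Qed.

Lemma kdiag_inv r (s : seq R) : size s = r -> all (fun x => 0 < x) s ->
  kdiag r s *m kdiag r (map (fun x => x^-1) s) = 1%:M.
Proof.
move=> hs /allP s0; apply/matrixP => i j; rewrite !mxE (bigD1 i) //= big1.
  rewrite !mxE eqxx addr0; case: ifP => [/eqP/ord_inj <-|/negP ij].
    rewrite (nth_map 0) ?hs// -rmorphM divff ?rmorph1 ?eqxx//.
    by rewrite gt_eqF// s0// mem_nth// hs.
  by rewrite rmorph0 mulr0; case: (i =P j) => // e; case: ij; rewrite e.
by move=> k /negbTE ki; rewrite !mxE -[_ == _ :> nat]/(i == k) eq_sym ki
  rmorph0 mul0r.
Qed.

(** A decomposition that keeps only the r singular triples, so that no basis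
    has to be completed: such decompositions can be added ([csvd_add]) and
    their triples permuted. *)
Definition csvd p q r (M : 'M[K]_(p, q))
    (U : 'M[K]_(p, r)) (s : seq R) (V : 'M[K]_(q, r)) : Prop :=
  [/\ orthonormal_cols U, orthonormal_cols V, M = U *m kdiag r s *m adj V,
      size s = r & all (fun x : R => 0 < x) s].

Lemma csvd_adj p q r (M : 'M[K]_(p, q))
    (U : 'M[K]_(p, r)) s (V : 'M[K]_(q, r)) :
  csvd M U s V -> csvd (adj M) V s U.
Proof. by case=> oU oV -> hs s0; split=> //; rewrite !adjM adjK adj_msigma
  mulmxA. Qed.

(** The left factor is recovered from M, so orthogonality statements about
    matrices transfer to their singular vectors. *)
Lemma csvd_left p q r (M : 'M[K]_(p, q))
    (U : 'M[K]_(p, r)) s (V : 'M[K]_(q, r)) :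
  csvd M U s V -> M *m V *m kdiag r (map (fun x => x^-1) s) = U.
Proof.
case=> oU oV -> hs s0.
by rewrite -(mulmxA _ (adj V)) oV mulmx1 -mulmxA kdiag_inv // mulmx1.
Qed.

Lemma orthonormal_cproj n r (U : 'M[K]_(n, r)) :
  orthonormal_cols U -> cproj U = U *m adj U.
Proof.
move=> oU; apply/esym; apply: (cproj_uniq (X := adj U)) => //.
  by split; rewrite ?adjM ?adjK// mulmxA -(mulmxA U) oU mulmx1.
by rewrite -mulmxA oU mulmx1.
Qed.

Lemma orthonormal_rank n r (U : 'M[K]_(n, r)) :
  orthonormal_cols U -> \rank U = r.
Proof.
move=> oU; apply/eqP; rewrite eqn_leq rank_leq_col /=.
by rewrite -[X in (X <= _)%N](mxrank1 K r) -oU mxrankM_maxr.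
Qed.

Lemma csvd_rank p q r (M : 'M[K]_(p, q))
    (U : 'M[K]_(p, r)) s (V : 'M[K]_(q, r)) :
  csvd M U s V -> \rank M = r.
Proof.
move=> h; have := csvd_left h; case: h => oU oV hM hs s0 hU.
apply/eqP; rewrite eqn_leq; apply/andP; split.
  by rewrite hM -mulmxA (leq_trans (mxrankM_maxl _ _))// rank_leq_col.
rewrite -[X in (X <= _)%N](mxrank1 K r) -oU -hU -mulmxA mulmxA.
by rewrite (leq_trans (mxrankM_maxl _ _))// mxrankM_maxr.
Qed.

Lemma csvd_cproj p q r (M : 'M[K]_(p, q))
    (U : 'M[K]_(p, r)) s (V : 'M[K]_(q, r)) :
  csvd M U s V -> cproj M = U *m adj U.
Proof.
move=> h; have hU := csvd_left h; case: h => oU oV hM hs s0; apply/esym.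
apply: (cproj_uniq (X := V *m kdiag r (map (fun x => x^-1) s) *m adj U)).
- by split; rewrite ?adjM ?adjK// mulmxA -(mulmxA U) oU mulmx1.
- by rewrite hM !mulmxA -(mulmxA U) oU mulmx1.
- by rewrite !mulmxA hU.
Qed.

Lemma orthonormal_row_mx n r1 r2 (U1 : 'M[K]_(n, r1)) (U2 : 'M[K]_(n, r2)) :
  orthonormal_cols U1 -> orthonormal_cols U2 -> adj U1 *m U2 = 0 ->
  orthonormal_cols (row_mx U1 U2).
Proof.
move=> o1 o2 h; have h' : adj U2 *m U1 = 0.
  by rewrite -[LHS]adjK adjM adjK h adjmx0.
by rewrite /orthonormal_cols adj_row_mx mul_col_row o1 o2 h h' -scalar_mx_block.
Qed.

(** Orthogonality of the column spaces and of the row spaces makes the two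
    families of singular vectors orthogonal to each other. *)
Lemma csvd_add p q r1 r2 (M1 M2 : 'M[K]_(p, q))
    (U1 : 'M[K]_(p, r1)) s1 (V1 : 'M[K]_(q, r1))
    (U2 : 'M[K]_(p, r2)) s2 (V2 : 'M[K]_(q, r2)) :
  csvd M1 U1 s1 V1 -> csvd M2 U2 s2 V2 ->
  adj M1 *m M2 = 0 -> M1 *m adj M2 = 0 ->
  csvd (M1 + M2) (row_mx U1 U2) (s1 ++ s2) (row_mx V1 V2).
Proof.
move=> h1 h2 l12 r12.
have U12 : adj U1 *m U2 = 0.
  rewrite -(csvd_left h1) -(csvd_left h2) !adjM !mulmxA -(mulmxA _ (adj M1)).
  by rewrite l12 mulmx0 !mul0mx.
have V12 : adj V1 *m V2 = 0.
  rewrite -(csvd_left (csvd_adj h1)) -(csvd_left (csvd_adj h2)) !adjM adjK.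
  by rewrite !mulmxA -(mulmxA _ M1) r12 mulmx0 !mul0mx.
case: h1 h2 => oU1 oV1 e1 z1 p1 [oU2 oV2 e2 z2 p2].
split; [exact: orthonormal_row_mx|exact: orthonormal_row_mx| | |].
- rewrite kdiag_cat// adj_row_mx mul_row_block mul_row_col.
  by rewrite !mulmx0 addr0 add0r -e1 -e2.
- by rewrite size_cat z1 z2.
- by rewrite all_cat p1.
Qed.

Lemma gram_rowE n (v : 'rV[K]_n) :
  exists2 t : R, 0 <= t & v *m adj v = (kreal F t)%:M.
Proof.
have [|t t0 e] := @ge0_kreal R F ((v *m adj v) 0 0).
  by rewrite mxE; apply: sumr_ge0 => i _; rewrite !mxE mul_kconj_ge0.
by exists t => //; rewrite -e -mx11_scalar.
Qed.

(** The eigenvalue is positive because it is the ratio of the squared lengths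
    of v adj M and v for the eigenvector v; its root is a singular value of
    M. *)
Lemma gram_eigenvector p q (M : 'M[K]_(p, q)) : M != 0 ->
  exists (s : R) (w : 'cV[K]_q), [/\ 0 < s, orthonormal_cols w
    & adj M *m M *m w = kreal F (s ^+ 2) *: w].
Proof.
move=> M0; have [] := @hermitian_eigenvector R F _ (adj M *m M).
- by rewrite adjM adjK.
- apply: contra M0 => /eqP h; apply/eqP/(@adjmx_inj R F); rewrite adjmx0.
  by apply: mulmx_adj_eq0; rewrite adjK.
move=> a [v [a0 v0 va]].
have [t t0 vv] := gram_rowE v; have [c c0 cc] := gram_rowE (v *m adj M).
have tgt0 : 0 < t.
  rewrite lt_neqAle t0 andbT eq_sym; apply: contra v0 => /eqP t_eq0.
  by apply/eqP/mulmx_adj_eq0; rewrite vv t_eq0 rmorph0 raddf0.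
have ac : a * t = c.
  apply: (fmorph_inj (@kreal R F)); rewrite rmorphM.
  move: cc; rewrite adjM adjK mulmxA -(mulmxA v) va -scalemxAl vv.
  by rewrite scale_scalar_mx => /matrixP /(_ 0 0); rewrite !mxE eqxx !mulr1n.
have agt0 : 0 < a by rewrite lt_neqAle eq_sym a0 -(pmulr_lge0 _ tgt0) ac.
exists (Num.sqrt a), (kreal F (Num.sqrt t)^-1 *: adj v); split.
- by rewrite sqrtr_gt0.
- rewrite /orthonormal_cols adjmxZ adjK kconj_kreal -scalemxAl -scalemxAr.
  rewrite vv scalerA -rmorphM scale_scalar_mx -rmorphM -invfM -expr2.
  by rewrite sqr_sqrtr ?mulVf ?rmorph1 ?gt_eqF.
- rewrite sqr_sqrtr ?(ltW agt0)// -scalemxAr scalerA mulrC -scalerA.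
  congr (_ *: _); have := congr1 (@adj R F _ _) va.
  by rewrite adjmxZ kconj_kreal !adjM adjK.
Qed.

(** M w is orthogonal to the image under M of the complement of w, and its
    length is s: this is the singular triple belonging to w. *)
Lemma csvd_rank_one p q (M : 'M[K]_(p, q)) (s : R) (w : 'cV[K]_q) :
  0 < s -> orthonormal_cols w -> adj M *m M *m w = kreal F (s ^+ 2) *: w ->
  csvd (M *m w *m adj w) (kreal F s^-1 *: (M *m w)) [:: s] w.
Proof.
move=> s0 ow Mw; split => //=; last by rewrite s0.
- rewrite /orthonormal_cols adjmxZ kconj_kreal -scalemxAl -scalemxAr scalerA.
  rewrite adjM -!mulmxA (mulmxA (adj M)) Mw -scalemxAr ow scalerA -!rmorphM.
  by rewrite -invfM -expr2 mulVf ?rmorph1 ?scale1r// sqrf_eq0 gt_eqF.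
- have -> : kdiag 1 [:: s] = (kreal F s)%:M.
    by apply/matrixP => i j; rewrite !mxE !ord1 eqxx mulr1n.
  by rewrite mul_mx_scalar scalerA -rmorphM mulfV ?rmorph1 ?scale1r ?gt_eqF.
Qed.

(** Induction on the rank.  Splitting off M w adj w for an eigenvector w of
    the Gram matrix leaves a remainder that kills w and whose row space stays
    inside that of M; as adj w belongs to the latter, the rank drops. *)
Lemma csvd_exists p q (M : 'M[K]_(p, q)) :
  exists r U s V, @csvd p q r M U s V.
Proof.
have [N] := ubnP (\rank M); elim: N M => // N IH M; rewrite ltnS => rM.
have [->|/gram_eigenvector[s [w [s0 ow Mw]]]] := eqVneq M 0.
  exists 0%N, 0, [::], 0; split => //; rewrite ?mul0mx//;
  by rewrite /orthonormal_cols [LHS]flatmx0 [RHS]flatmx0.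
have wM : adj w *m (adj M *m M) = kreal F (s ^+ 2) *: adj w.
  have := congr1 (@adj R F _ _) Mw.
  by rewrite adjmxZ kconj_kreal !adjM adjK.
have s2 : kreal F (s ^+ 2) != 0 by rewrite fmorph_eq0 sqrf_eq0 gt_eqF.
pose M1 := M *m w *m adj w; pose M2 := M - M1.
have M2w : M2 *m w = 0 by rewrite mulmxBl -mulmxA ow mulmx1 subrr.
have wE : adj w = (kreal F (s ^+ 2))^-1 *: adj w *m adj M *m M.
  by rewrite -mulmxA -scalemxAl wM scalerA mulVf// scale1r.
have w0 : adj w *m w != 0 by rewrite ow -mxrank_eq0 mxrank1.
have [|r [U [s' [V h]]]] := IH M2.
  apply: leq_trans rM; apply: rank_ltmx; rewrite ltmxE; apply/andP; split.
    by rewrite /M2 /M1 wE addmx_sub// eqmx_opp mulmxA submxMl.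
  apply: contra w0 => /submxP[D MD].
  by rewrite wE {2}MD mulmxA -(mulmxA _ M2) M2w mulmx0.
exists (1 + r)%N; rewrite -[M](subrK M1) addrC -/M2.
do 3!eexists; apply: csvd_add (csvd_rank_one s0 ow Mw) h _ _.
- have M1M : adj M1 *m M = w *m (kreal F (s ^+ 2) *: adj w).
    by rewrite /M1 !adjM adjK -wM !mulmxA.
  rewrite /M2 mulmxBr M1M /M1 !mulmxA M1M -!scalemxAr -!scalemxAl.
  by rewrite -!(mulmxA w) ow mul1mx subrr.
- by rewrite /M1 -mulmxA -adjM M2w adjmx0 mulmx0.
Qed.

Lemma cproj_factor p q (M : 'M[K]_(p, q)) :
  exists r (U : 'M[K]_(p, r)), orthonormal_cols U /\ cproj M = U *m adj U.
Proof.
have [r [U [s [V h]]]] := csvd_exists M.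
by exists r, U; rewrite (csvd_cproj h); case: h.
Qed.

End CompactSVD.

(** * Full singular value decompositions *)

Section FullSVD.
Variables (R : realType) (F : scalars).
Local Notation K := (scalar_field R F).

(** The diagonal is a function of the index, so that spectral projections
    are diagonals of indicator functions. *)
Definition rdiag n (f : 'I_n -> R) : 'M[K]_n := diag_mx (\row_i kreal F (f i)).

Lemma eq_rdiag n (f g : 'I_n -> R) : f =1 g -> rdiag f = rdiag g.
Proof. by move=> fg; congr diag_mx; apply/rowP => i; rewrite !mxE fg. Qed.

Lemma rdiagC n (f g : 'I_n -> R) : rdiag f *m rdiag g = rdiag g *m rdiag f.
Proof. exact: diag_mxC. Qed.

Lemma adj_rdiag n (f : 'I_n -> R) : adj (rdiag f) = rdiag f.
Proof.
apply/matrixP => i j; rewrite !mxE rmorphMn /= kconj_kreal eq_sym.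
by case: eqP => // ->.
Qed.

Lemma rdiag1 n : rdiag (fun _ : 'I_n => 1) = 1%:M.
Proof. by rewrite -diag_const_mx; congr diag_mx; apply/rowP => i; rewrite !mxE
  rmorph1. Qed.

Lemma rdiag0 n : rdiag (fun _ : 'I_n => 0) = 0.
Proof. by apply/matrixP => i j; rewrite !mxE rmorph0 mul0rn. Qed.

Lemma rdiag_split n1 n2 (f : 'I_(n1 + n2) -> R) :
  rdiag f = block_mx (rdiag (fun i => f (lshift n2 i))) 0 0
                     (rdiag (fun i => f (rshift n1 i))).
Proof.
rewrite /rdiag -diag_mx_row; congr diag_mx; apply/rowP => i.
by rewrite !mxE; case: splitP => j ij; rewrite mxE; congr (kreal _ (f _));
  apply: val_inj.
Qed.

Lemma kdiagE r (s : seq R) : @kdiag R F r s = rdiag (fun i : 'I_r => s`_i).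
Proof.
apply/matrixP => i j; rewrite !mxE -[_ == _ :> nat]/(i == j).
by case: eqP => _; rewrite ?mulr1n// mulr0n rmorph0.
Qed.

(** The size bound matters: an entry of s beyond index q does not occur in
    the left-hand side. *)
Lemma msigma_mul p q s t : (size s <= q)%N ->
  msigma F p q s *m msigma F q p t = rdiag (fun i : 'I_p => s`_i * t`_i).
Proof.
move=> sq; apply/matrixP => i j; rewrite !mxE.
have [iq|iq] := ltnP i q; last first.
  rewrite nth_default ?mul0r ?(leq_trans sq)// rmorph0 mul0rn.
  by rewrite big1// => k _; rewrite !mxE gtn_eqF ?rmorph0 ?mul0r// (leq_trans _
    iq).
rewrite (bigD1 (Ordinal iq))//= big1 ?addr0 => [|k ki]; last first.
  rewrite !mxE; case: eqP => [ik|_]; last by rewrite rmorph0 mul0r.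
  by case/eqP: ki; apply: val_inj.
rewrite !mxE /= eqxx -[_ == _ :> nat]/(i == j) rmorphM.
by case: eqP => _; rewrite ?mulr1n// rmorph0 mulr0.
Qed.

Lemma msigma_block r c d s : size s = r ->
  msigma F (r + c) (r + d) s = block_mx (@kdiag R F r s) 0 0 0.
Proof.
move=> hs; apply/matrixP => i j; rewrite !mxE.
case: splitP => k ik; rewrite !mxE; case: splitP => l jl; rewrite !mxE ik jl//.
- by rewrite (ltn_eqF (ltn_addr l (ltn_ord k))) rmorph0.
- by rewrite nth_default ?if_same ?rmorph0 ?hs ?leq_addr.
- by rewrite nth_default ?if_same ?rmorph0 ?hs ?leq_addr.
Qed.

Section OfSVD.
Variables (p q : nat) (M : 'M[K]_(p, q)) (U : 'M[K]_p).
Variables (s : seq R) (V : 'M[K]_q).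
Hypothesis svdM : unordered_svd M U s V.

Lemma unordered_svd_msigma : adj U *m M *m V = msigma F p q s.
Proof.
by case: svdM => -[uU _] [uV _] -> _ _; rewrite !mulmxA uU mul1mx -mulmxA uV
  mulmx1.
Qed.

Lemma unordered_svd_gram :
  adj M *m M = V *m rdiag (fun j => s`_j ^+ 2) *m adj V.
Proof.
case: svdM => -[uU _] _ -> hs _; rewrite !adjM adjK !mulmxA -(mulmxA _ (adj U))
  uU mulmx1.
by rewrite -!mulmxA (mulmxA (adj _)) -/(msigma F p q s) adj_msigma msigma_mul//
  hs rank_leq_row.
Qed.

Lemma unordered_svd_cproj :
  cproj M = U *m rdiag (fun i => (i < \rank M)%:R) *m adj U.
Proof.
case: svdM => -[uU _] [uV _] hM hs s0; rewrite -hs; apply/esym.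
pose t := map (fun x => x^-1) s.
have sq : (size s <= q)%N by rewrite hs rank_leq_col.
have E : rdiag (fun i => (i < size s)%:R) = msigma F p q s *m msigma F q p t.
  rewrite msigma_mul//; apply: eq_rdiag => i; have [ir|ir] := ltnP i.
    rewrite (nth_map 0)// divff// gt_eqF//.
    by have /allP := s0; apply; rewrite mem_nth.
  by rewrite nth_default// mul0r.
apply: (cproj_uniq (X := V *m msigma F q p t *m adj U)).
- split; last by rewrite !adjM adj_rdiag adjK mulmxA.
  rewrite !mulmxA -(mulmxA _ (adj U)) uU mulmx1 -!mulmxA; congr (_ *m _).
  rewrite mulmxA; congr (_ *m _); rewrite /rdiag mulmx_diag.
  by congr diag_mx; apply/rowP => i; rewrite !mxE -rmorphM -natrM mulnb andbb.
- rewrite hM !mulmxA -(mulmxA _ (adj U)) uU mulmx1; congr (_ *m _).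
  rewrite -mulmxA; congr (_ *m _); rewrite mul_diag_mx.
  apply/matrixP => i j; rewrite !mxE -rmorphM; congr (kreal _ _).
  case: eqP => _; last by rewrite mulr0.
  have [ir|ir] := ltnP i (size s); first by rewrite mul1r.
  by rewrite nth_default// mulr0.
- by rewrite {1}hM E !mulmxA -(mulmxA _ (adj V)) uV mulmx1.
Qed.

End OfSVD.

Lemma rank_cproj m n (M : 'M[K]_(m, n)) : \rank (cproj M) = \rank M.
Proof.
apply/eqP; rewrite eqn_leq -{3}(cproj_mul M) mxrankM_maxl andbT.
by rewrite cprojE mxrankM_maxl.
Qed.

(** An orthonormal basis of the column space of 1 - U adj U, obtained from a
    singular value decomposition of that projection. *)
Lemma orthonormal_complement n r (U : 'M[K]_(n, r)) : orthonormal_cols U ->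
  exists c (U2 : 'M[K]_(n, c)), [/\ orthonormal_cols U2, adj U *m U2 = 0,
    U *m adj U + U2 *m adj U2 = 1%:M & (r + c)%N = n].
Proof.
move=> oU; have [c [U2 [oU2]]] := cproj_factor (1%:M - U *m adj U).
rewrite -(orthonormal_cproj oU) cproj_id => [e|]; last first.
  exact/orthogonal_projection_compl/orthogonal_projection_cproj.
rewrite orthonormal_cproj// in e *.
have sum1 : U *m adj U + U2 *m adj U2 = 1%:M by rewrite -e addrC subrK.
have UU2 : adj U *m U2 = 0.
  have -> : U2 = U2 *m adj U2 *m U2 by rewrite -mulmxA oU2 mulmx1.
  by rewrite -e mulmxA mulmxBr mulmx1 mulmxA oU mul1mx subrr mul0mx.
exists c, U2; split=> //.
have oW := orthonormal_row_mx oU oU2 UU2.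
rewrite -(orthonormal_rank oW) -(rank_cproj (row_mx U U2)).
by rewrite (orthonormal_cproj oW) adj_row_mx mul_row_col sum1 mxrank1.
Qed.

Lemma unitary_row_mx r c (U1 : 'M[K]_(r + c, r)) (U2 : 'M[K]_(r + c, c)) :
  orthonormal_cols U1 -> orthonormal_cols U2 -> adj U1 *m U2 = 0 ->
  unitary (row_mx U1 U2).
Proof.
move=> o1 o2 h; have oW := orthonormal_row_mx o1 o2 h.
by split=> //; exact: mulmx1C.
Qed.

(** Any completions of both families of singular vectors to orthonormal bases
    will do: the added vectors meet only zero singular values. *)
Lemma csvd_extend r c d (M : 'M[K]_(r + c, r + d)) U1 s V1 U2 V2 :
  csvd M U1 s V1 -> unitary (row_mx U1 U2) -> unitary (row_mx V1 V2) ->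
  unordered_svd M (row_mx U1 U2) s (row_mx V1 V2).
Proof.
move=> h uU uV; have rM := csvd_rank h; case: h => _ _ hM hs s0.
split; rewrite ?rM// -/(msigma F _ _ _) msigma_block// adj_row_mx.
by rewrite mul_row_block !mulmx0 !addr0 mul_row_col mul0mx addr0.
Qed.

Lemma csvd_col_perm p q r (M : 'M[K]_(p, q)) U s V (g : 'S_r) (s' : seq R) :
  csvd M U s V -> size s' = r -> (forall i : 'I_r, s'`_i = s`_(g i)) ->
  csvd M (col_perm g U) s' (col_perm g V).
Proof.
case=> oU oV hM hs /allP s0 hs' gs.
have o n (W : 'M[K]_(n, r)) : orthonormal_cols W -> orthonormal_cols (col_perm
  g W).
  move=> oW; apply/matrixP => i j; have /matrixP/(_ (g i) (g j)) := oW.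
  rewrite !mxE (inj_eq perm_inj) => <-.
  by apply: eq_bigr => k _; rewrite !mxE.
split=> //; [exact: o|exact: o| |].
  rewrite hM !kdiagE; apply/matrixP => i j; rewrite !mul_mx_diag !mxE.
  rewrite (reindex_inj (@perm_inj _ g)); apply: eq_bigr => k _.
  by rewrite !mxE gs.
apply/allP => x /(nthP 0)[k]; rewrite hs' => ir <-.
by rewrite -[k]/(nat_of_ord (Ordinal ir)) gs s0// mem_nth ?hs.
Qed.

Lemma csvd_sort p q r (M : 'M[K]_(p, q)) U s V : @csvd R F p q r M U s V ->
  exists (g : 'S_r) s', csvd M (col_perm g U) s' (col_perm g V)
    /\ sorted (fun x y : R => y <= x) s'.
Proof.
move=> h; have hs : size s = r by case: h.
pose s' := sort (fun x y : R => y <= x) s.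
have hs' : size s' = r by rewrite size_sort.
have : perm_eq s' s by rewrite perm_sort.
rewrite -[s]/(tval (Tuple (introT eqP hs))) => /tuple_permP[g sg].
exists g, s'; split; last by apply: sort_sorted => x y; exact: le_total.
apply: csvd_col_perm h hs' _ => i.
by rewrite sg -tnth_nth tnth_mktuple (tnth_nth 0).
Qed.

Lemma csvd_unordered_svd p q r (M : 'M[K]_(p, q)) U s V :
  @csvd R F p q r M U s V -> exists X Y, unordered_svd M X s Y.
Proof.
move=> h; have [oU oV _ _ _] := h.
have [c [U2 [oU2 U12 _ ep]]] := orthonormal_complement oU.
have [d [V2 [oV2 V12 _ eq]]] := orthonormal_complement oV.
subst p q; exists (row_mx U U2), (row_mx V V2).
by apply: csvd_extend h _ _; apply: unitary_row_mx.
Qed.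

Lemma unordered_svd_exists p q (M : 'M[K]_(p, q)) :
  exists U s V, unordered_svd M U s V.
Proof.
have [r [U [s [V /csvd_unordered_svd[X [Y h]]]]]] := csvd_exists M.
by exists X, s, Y.
Qed.

End FullSVD.

(** * The block form of the transition matrix *)

Section BlockForm.
Variables (R : realType) (F : scalars).
Local Notation K := (scalar_field R F).

(** Indicators of the indices below r and of the r indices from p on.  They
    turn the block form of a unitary W into the single matrix identity
    W *m initial_ind *m adj W = interval_ind, free of dependent block sizes. *)
Definition initial_ind n r : 'M[K]_n := rdiag F (fun i : 'I_n => (i < r)%:R).
Definition interval_ind n p r : 'M[K]_n :=
  rdiag F (fun i : 'I_n => (p <= i < p + r)%:R).

Lemma initial_ind_block r c : initial_ind (r + c) r = block_mx 1%:M 0 0 0.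
Proof.
rewrite /initial_ind rdiag_split -rdiag1 -rdiag0; congr block_mx; apply:
  eq_rdiag => i /=.
  by rewrite ltn_ord.
by rewrite ltnNge leq_addr.
Qed.

Lemma interval_ind_block p r q :
  interval_ind (p + (r + q)) p r = block_mx 0 0 0 (block_mx 1%:M 0 0 0).
Proof.
rewrite /interval_ind rdiag_split -{1}rdiag0 -initial_ind_block.
congr block_mx; apply: eq_rdiag => i /=.
  by rewrite leqNgt ltn_ord.
by rewrite leq_addr ltn_add2l.
Qed.

Lemma interval_ind_rows p r q :
  interval_ind (p + (r + q)) p r =
  col_mx 0 (col_mx (row_mx 0 (row_mx 1%:M 0)) 0).
Proof.
rewrite interval_ind_block /block_mx row_mx0; congr col_mx.
by rewrite -[X in row_mx X (col_mx _ _)]col_mx0 -block_mxEh /block_mx !row_mx0.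
Qed.

(** Since W intertwines the two indicators, the entries whose row and column
    disagree about them vanish; the identity restricted to the interval says
    that the remaining square block is unitary. *)
Lemma block_column_formP n p r (W : 'M[K]_n) : (p + r <= n)%N ->
  adj W *m W = 1%:M ->
  W *m initial_ind n r *m adj W = interval_ind n p r ->
  exists Q : 'M[K]_r, unitary Q /\ block_column_form Q W.
Proof.
move=> prn WW hW.
have hW2 : W *m initial_ind n r = interval_ind n p r *m W.
  by rewrite -hW -[RHS]mulmxA WW mulmx1.
have hr : (p + (r + (n - (p + r))) = n)%N by rewrite addnA subnKC.
have hc : (r + (n - r) = n)%N by rewrite subnKC// (leq_trans (leq_addl p r)).
move: hr hc; set q := (n - (p + r))%N; set c := (n - r)%N => hr hc.
suff [Q [X [Y [uQ eW]]]] :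
    exists (Q : 'M[K]_r) (X : 'M[K]_(p, c)) (Y : 'M[K]_(q, c)),
    unitary Q /\ W = castmx (hr, hc)
      (col_mx (row_mx 0 X) (col_mx (row_mx Q 0) (row_mx 0 Y))).
  by exists Q; split=> //; exists p, q, c, X, Y, hr, hc.
clearbody q c; clear WW prn.
(* Rows and columns get separate dimensions so that both casts disappear. *)
suff H n1 n2 (h1 : (p + (r + q))%N = n1) (h2 : (r + c)%N = n2)
    (Z : 'M[K]_(n1, n2)) :
    Z *m initial_ind n2 r *m adj Z = interval_ind n1 p r ->
    Z *m initial_ind n2 r = interval_ind n1 p r *m Z ->
    exists (Q : 'M[K]_r) (X : 'M[K]_(p, c)) (Y : 'M[K]_(q, c)),
    unitary Q /\ Z = castmx (h1, h2)
      (col_mx (row_mx 0 X) (col_mx (row_mx Q 0) (row_mx 0 Y))).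
  exact: H hW hW2.
case: n1 / h1 Z; case: n2 / h2 => Z.
rewrite initial_ind_block {1}interval_ind_rows interval_ind_block.
rewrite -[Z]vsubmxK -[dsubmx Z]vsubmxK -[usubmx Z]hsubmxK.
rewrite -[usubmx (dsubmx Z)]hsubmxK -[dsubmx (dsubmx Z)]hsubmxK.
move: (lsubmx _) (rsubmx _) (lsubmx _) (rsubmx _) (lsubmx _) (rsubmx _).
move=> d Y Q b a X.
rewrite !mul_block_col !mul_col_mx !mul_row_block !mulmx0 !mul0mx !mulmx1
  ?addr0 ?add0r.
have row0 k1 k2 k3 (e : 'M[K]_(k1, k2)) :
    row_mx e (0 : 'M[K]_(k1, k3)) = 0 -> e = 0.
  by move/(congr1 lsubmx); rewrite row_mxKl linear0.
rewrite mul1mx => hQ /eq_col_mx[/row0 a0] /eq_col_mx[/eq_row_mx[_ b0] /row0 d0].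
move: hQ; rewrite -b0 a0 d0.
rewrite !adj_col_mx !adj_row_mx !mul_mx_row !mul_row_col !adjmx0 !mulmx0
  !mul0mx !addr0.
move=> /eq_col_mx[_ /eq_col_mx[/eq_row_mx[_ /eq_row_mx[QQ _]] _]].
exists Q, X, Y; split; rewrite ?castmx_id//.
by split=> //; exact: mulmx1C.
Qed.

Lemma block_column_form_ind n r (Q : 'M[K]_r) (W : 'M[K]_n) :
  unitary Q -> block_column_form Q W ->
  exists p, W *m initial_ind n r *m adj W = interval_ind n p r.
Proof.
move=> [_ QQ] [p [q [c [X [Y [hr [hc ->]]]]]]]; exists p.
suff H n1 n2 (h1 : (p + (r + q))%N = n1) (h2 : (r + c)%N = n2) :
    let Z := castmx (h1, h2)
      (col_mx (row_mx 0 X) (col_mx (row_mx Q 0) (row_mx 0 Y))) in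
    Z *m initial_ind n2 r *m adj Z = interval_ind n1 p r.
  exact: H.
case: n1 / h1; case: n2 / h2; rewrite castmx_id initial_ind_block
  interval_ind_rows /=.
rewrite !mul_col_mx !mul_row_block !mulmx0 !mul0mx !mulmx1 !addr0 !adj_col_mx
  !adj_row_mx !mul_mx_row !mul_row_col !adjmx0 !mulmx0 !mul0mx !(addr0, add0r)
  QQ.
by rewrite !row_mx0.
Qed.
End BlockForm.

(** * Singular vectors adapted to a second matrix *)

Section JointSVD.
Variables (R : realType) (F : scalars).
Local Notation K := (scalar_field R F).

Lemma orthonormal_perp n r1 r2 (U1 : 'M[K]_(n, r1)) (U2 : 'M[K]_(n, r2)) :
  orthonormal_cols U1 -> orthonormal_cols U2 ->
  U1 *m adj U1 *m (U2 *m adj U2) = 0 -> adj U1 *m U2 = 0.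
Proof.
move=> o1 o2 h.
have -> : adj U1 *m U2 = adj U1 *m (U1 *m adj U1 *m (U2 *m adj U2)) *m U2.
  by rewrite !mulmxA o1 mul1mx -!mulmxA o2 mulmx1.
by rewrite h mulmx0 mul0mx.
Qed.

Lemma interval_ind_block4 p r1 r2 q :
  interval_ind R F (p + r1 + (r2 + q)) p (r1 + r2) =
  block_mx (block_mx 0 0 0 1%:M) 0 0 (block_mx 1%:M 0 0 0).
Proof.
rewrite /interval_ind !rdiag_split -(rdiag0 R F p) -(rdiag0 R F q).
rewrite -(rdiag1 R F r1) -(rdiag1 R F r2).
congr (block_mx (block_mx _ _ _ _) _ _ (block_mx _ _ _ _)).
- by apply: eq_rdiag => i /=; rewrite leqNgt ltn_ord.
- by apply: eq_rdiag => i /=; rewrite leq_addr ltn_add2l ltn_addr.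
- apply: eq_rdiag => i /=.
  by rewrite -addnA leq_addr ltn_add2l ltn_add2l ltn_ord.
- apply: eq_rdiag => i /=.
  by rewrite [(_ < _)%N]ltnNge !addnA leq_addr andbF.
Qed.

(** The columns of V1 come from A Q and those of V2 from A (1 - Q).  Invariance
    makes the column spaces of these two matrices orthogonal, so their
    decompositions add up to one of A. *)
Lemma gram_invariant_csvd m n k (A : 'M[K]_(m, n)) (B : 'M[K]_(n, k)) :
  gram_invariant A B ->
  exists r2 r1 (U : 'M[K]_(m, r2 + r1)) s
      (V2 : 'M[K]_(n, r2)) (V1 : 'M[K]_(n, r1)),
    csvd A U s (row_mx V2 V1) /\ cproj (adj A) *m cproj B = V1 *m adj V1.
Proof.
move=> h; have comm := gram_invariant_commute h.
pose A1 := A *m cproj B; pose A2 := A - A1.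
have [r2 [U2 [s2 [V2 h2]]]] := csvd_exists A2.
have [r1 [U1 [s1 [V1 h1]]]] := csvd_exists A1.
exists r2, r1, (row_mx U2 U1), (s2 ++ s1), V2, V1; split.
  rewrite -[A](subrK A1) -/A2; apply: csvd_add h2 h1 _ _.
    rewrite /A2 /A1 adjmxB !adjM adj_cproj mulmxBl !mulmxA.
    by rewrite -(mulmxA (cproj B) (adj A) A) h -!mulmxA cproj_idem subrr.
  rewrite /A2 /A1 !adjM adj_cproj mulmxBl !mulmxA -(mulmxA A (cproj B) (cproj
    B)) cproj_idem.
  by rewrite subrr.
rewrite -(csvd_cproj (csvd_adj h1)); apply: (cproj_uniq (X := adj (mpinv A))).
- by apply: orthogonal_projectionM => //; exact: orthogonal_projection_cproj.
- rewrite adjM adj_cproj comm -!mulmxA (mulmxA (cproj (adj A))) comm -!mulmxA.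
  by rewrite cproj_mul mulmxA cproj_idem.
- by rewrite adjM adj_cproj comm -mulmxA [cproj (adj A)]cprojE mpinv_adj.
Qed.

(** The right singular vectors are arranged as V2, V1, V3, V4: first those
    with positive singular value, outside (V2) and inside (V1) the column space
    of B, then those in the kernel of A, inside (V3) and outside (V4).  Hence
    the ones inside are consecutive. *)
Lemma joint_svd m n k (A : 'M[K]_(m, n)) (B : 'M[K]_(n, k)) :
  gram_invariant A B ->
  exists p U s V, [/\ unordered_svd A U s V, (p + \rank B <= n)%N
    & cproj B = V *m interval_ind R F n p (\rank B) *m adj V].
Proof.
move=> h; have comm := gram_invariant_commute h.
have [p [r1 [U1 [s [V2 [V1 [hA V1E]]]]]]] := gram_invariant_csvd h.
have [oU1 oV21 _ _ _] := hA.
have V21E := csvd_cproj (csvd_adj hA).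
have pP : orthogonal_projection (cproj B - cproj (adj A) *m cproj B).
  have [i12 a12] : orthogonal_projection (cproj (adj A) *m cproj B).
    by apply: orthogonal_projectionM => //; exact: orthogonal_projection_cproj.
  split; last by rewrite adjmxB a12 adj_cproj.
  rewrite mulmxBl !mulmxBr i12 cproj_idem -[X in _ - (X - _)]mulmxA cproj_idem.
  by rewrite comm mulmxA cproj_idem subrr subr0.
have [r3 [V3 [oV3]]] := cproj_factor (cproj B - cproj (adj A) *m cproj B).
rewrite (cproj_id pP) => V3E.
have V21_3 : adj (row_mx V2 V1) *m V3 = 0.
  apply: orthonormal_perp => //; rewrite -V21E -V3E mulmxBr mulmxA cproj_idem.
  by rewrite subrr.
have oV213 := orthonormal_row_mx oV21 oV3 V21_3.
have [r4 [V4 [oV4 V213_4 _ en]]] := orthonormal_complement oV213.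
move: V213_4; rewrite adj_row_mx mul_col_mx -[0]col_mx0 => /eq_col_mx[V21_4
  V3_4].
have oV34 := orthonormal_row_mx oV3 oV4 V3_4.
have [c [U2 [oU2 U12 _ em]]] := orthonormal_complement oU1.
have BE : cproj B = V1 *m adj V1 + V3 *m adj V3 by rewrite -V3E -V1E addrC
  subrK.
have rB : \rank B = (r1 + r3)%N.
  have oV13 : orthonormal_cols (row_mx V1 V3).
    apply: orthonormal_row_mx => //.
      move: oV21; rewrite /orthonormal_cols adj_row_mx mul_col_row
        scalar_mx_block.
      by case/eq_block_mx.
    by move: V21_3; rewrite adj_row_mx mul_col_mx -[0]col_mx0 => /eq_col_mx[].
  rewrite -rank_cproj BE -(orthonormal_rank oV13) -(rank_cproj (row_mx V1 V3)).
  by rewrite orthonormal_cproj// adj_row_mx mul_row_col.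
move: en; rewrite -addnA => en; subst m n.
exists p, (row_mx U1 U2), s, (row_mx (row_mx V2 V1) (row_mx V3 V4)).
split.
- apply: csvd_extend => //; apply: unitary_row_mx => //.
  by rewrite mul_mx_row V21_3 V21_4 row_mx0.
- by rewrite rB !addnA leq_addr.
rewrite rB interval_ind_block4 mul_row_block !mulmx0 addr0 add0r.
rewrite !mul_row_block !mulmx0 !mulmx1 !addr0 !add0r.
by rewrite !adj_row_mx !mul_row_col !mul0mx add0r addr0.
Qed.

End JointSVD.

(** * Subspaces spanned by singular vectors *)

Section Spanned.
Variables (R : realType) (F : scalars).
Local Notation K := (scalar_field R F).

Definition set_ind n (J : {set 'I_n}) : 'M[K]_n :=
  rdiag F (fun j => (j \in J)%:R).

Lemma set_ind_idem n (J : {set 'I_n}) : set_ind J *m set_ind J = set_ind J.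
Proof.
rewrite /set_ind /rdiag mulmx_diag; congr diag_mx; apply/rowP => i.
by rewrite !mxE -rmorphM -natrM mulnb andbb.
Qed.

Lemma orthogonal_projection_set_ind n (V : 'M[K]_n) (J : {set 'I_n}) :
  orthonormal_cols V -> orthogonal_projection (V *m set_ind J *m adj V).
Proof.
move=> oV; split; last by rewrite !adjM adjK adj_rdiag mulmxA.
by rewrite !mulmxA -(mulmxA _ (adj V)) oV mulmx1 -(mulmxA V) set_ind_idem.
Qed.

Lemma conj_rdiag_commute n (V : 'M[K]_n) (f g : 'I_n -> R) :
  adj V *m V = 1%:M ->
  V *m rdiag F f *m adj V *m (V *m rdiag F g *m adj V) =
  V *m rdiag F g *m adj V *m (V *m rdiag F f *m adj V).
Proof.
move=> VV; rewrite !mulmxA -!(mulmxA _ (adj V) V) VV !mulmx1.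
by rewrite -!(mulmxA V) rdiagC.
Qed.

Lemma unordered_svd_unitary p q (M : 'M[K]_(p, q)) U s V :
  unordered_svd M U s V -> unitary U /\ unitary V.
Proof. by case. Qed.

(** In the basis V_A the projection onto the column space of B becomes
    W *m initial_ind *m adj W with W = adj V_A *m U_B, and S becomes diagonal.
    The block form says that the former is diagonal as well. *)
Lemma unordered_svd_block m n k r (A : 'M[K]_(m, n)) (B : 'M[K]_(n, k)) :
  \rank B = r ->
  (exists UA sA VA UB sB VB (Q : 'M[K]_r),
     [/\ unordered_svd A UA sA VA, unordered_svd B UB sB VB,
         unitary Q & block_column_form Q (adj VA *m UB)])
  <-> gram_invariant A B.
Proof.
move=> hr; split.
  move=> [UA [sA [VA [UB [sB [VB [Q [svdA svdB uQ]]]]]]]].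
  case/(block_column_form_ind uQ) => p.
  rewrite adjM adjK -hr => hW.
  have [_ [vA1 vA2]] := unordered_svd_unitary svdA.
  have BE : cproj B = VA *m interval_ind R F n p (\rank B) *m adj VA.
    rewrite -hW !mulmxA vA2 mul1mx -[RHS]mulmxA vA2 mulmx1.
    exact: unordered_svd_cproj svdB.
  rewrite /gram_invariant BE (unordered_svd_gram svdA).
  exact: conj_rdiag_commute.
move=> /joint_svd[p [UA [sA [VA [svdA pn BE]]]]].
have [UB [sB [VB svdB]]] := unordered_svd_exists B.
have [_ [vA1 vA2]] := unordered_svd_unitary svdA.
have [[uB1 uB2] _] := unordered_svd_unitary svdB.
have [|||Q [uQ bQ]] := @block_column_formP _ _ n p r (adj VA *m UB).
- by rewrite -hr.
- by rewrite adjM adjK mulmxA -(mulmxA _ VA) vA2 mulmx1.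
- rewrite adjM adjK -hr !mulmxA.
  have -> : adj VA *m UB *m initial_ind R F n (\rank B) *m adj UB *m VA =
      adj VA *m cproj B *m VA.
    by rewrite (unordered_svd_cproj svdB) !mulmxA.
  by rewrite BE !mulmxA vA1 mul1mx -mulmxA vA1 mulmx1.
by exists UA, sA, VA, UB, sB, VB, Q.
Qed.

Lemma col_perm_rdiag n r (V : 'M[K]_(n, r)) (g : 'S_r) (f : 'I_r -> R) :
  col_perm g V *m rdiag F (f \o g) *m adj (col_perm g V) =
  V *m rdiag F f *m adj V.
Proof.
apply/matrixP => i j; rewrite !mul_mx_diag !mxE.
rewrite [RHS](reindex_inj (@perm_inj _ g)).
by apply: eq_bigr => l _; rewrite !mxE.
Qed.

(** Singular values may be sorted and the bases completed while following a
    chosen set of right singular vectors, through the projection onto its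
    span. *)
Lemma csvd_sort_extend p q r (M : 'M[K]_(p, q)) U s V (f : pred 'I_r) :
  csvd M U s V ->
  exists U' s' V' (J : {set 'I_q}), [/\ svd M U' s' V',
    forall j, j \in J -> (j < \rank M)%N
    & V' *m set_ind J *m adj V' =
      V *m rdiag F (fun i => (f i)%:R) *m adj V].
Proof.
move=> h; rewrite (csvd_rank h); have [g [s' [{}h sorted_s]]] := csvd_sort h.
rewrite -(col_perm_rdiag V g).
move: (col_perm g V) h => {}V; move: (col_perm g U) => {}U h.
have [oU oV _ _ _] := h.
have [c [U2 [oU2 U12 _ ep]]] := orthonormal_complement oU.
have [d [V2 [oV2 V12 _ eq]]] := orthonormal_complement oV.
subst p q.
exists (row_mx U U2), s', (row_mx V V2), [set lshift d i | i in [set i | f (g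
  i)]].
split.
- by split=> //; apply: csvd_extend h _ _; apply: unitary_row_mx.
- by move=> j /imsetP[i _ ->] /=.
rewrite /set_ind rdiag_split adj_row_mx.
have -> : rdiag F (fun i => (rshift r i \in
    [set lshift d i | i in [set i | f (g i)]])%:R) = 0 :> 'M[K]_d.
  rewrite -rdiag0; apply: eq_rdiag => i; case: imsetP => // -[j _ /eqP].
  by rewrite eq_rlshift.
rewrite mul_row_block !mulmx0 !addr0 mul_row_col mul0mx addr0.
congr (_ *m _ *m _); apply: eq_rdiag => i /=.
by rewrite mem_imset ?inE//; exact: lshift_inj.
Qed.

Lemma colspace_sum_cols n (V : 'M[K]_n) (J : {set 'I_n}) : orthonormal_cols V ->
  (colspace (V *m set_ind J *m adj V)
     == \sum_(j in J) colspace (col j V))%MS.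
Proof.
move=> oV; apply/andP; split.
  have -> : V *m set_ind J *m adj V = \sum_(j in J) col j V *m adj (col j V).
    apply/matrixP => i j; rewrite mul_mx_diag summxE mxE [RHS]big_mkcond.
    apply: eq_bigr => l _; rewrite !mxE; case: ifP => _.
      by rewrite rmorph1 mulr1 big_ord1 !mxE.
    by rewrite rmorph0 mulr0 mul0r.
  rewrite /colspace genmxE raddf_sum /=; apply: summx_sub_sums => j _.
  by rewrite genmxE trmx_mul submxMl.
apply/sumsmx_subP => j jJ; apply/colspace_subP.
rewrite cproj_id; last exact: orthogonal_projection_set_ind.
rewrite colE !mulmxA -(mulmxA _ (adj V)) oV mulmx1 -mulmxA; congr (_ *m _).
rewrite mul_diag_mx; apply/matrixP => i l; rewrite !mxE.
by case: eqP => [->|_]; rewrite ?mulr0// jJ rmorph1 mul1r.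
Qed.

(** The vectors V1 of [gram_invariant_csvd] span the intersection, since
    P Q = V1 adj V1. *)
Lemma gram_invariant_spanned m n k (A : 'M[K]_(m, n)) (B : 'M[K]_(n, k)) :
  gram_invariant A B ->
  spanned_by_right_singular_vectors A (colspace (adj A) :&: colspace B)%MS.
Proof.
move=> h; have comm := gram_invariant_commute h.
have [r2 [r1 [U [s [V2 [V1 [hA V1E]]]]]]] := gram_invariant_csvd h.
have := csvd_sort_extend (fun i : 'I_(r2 + r1) => (r2 <= i)%N) hA.
move=> [U' [s' [V' [J [svdA Jr VJ]]]]].
exists U', s', V'; split=> //; exists J => //.
have [/unordered_svd_unitary[_ [oV' _]] _] := svdA.
apply/eqmxP; apply: eqmx_trans (eqmxP (colspace_sum_cols J oV')).
apply: eqmx_trans (eqmx_sym (eqmxP (colspace_cap comm))) _.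
suff -> : cproj (adj A) *m cproj B = V' *m set_ind J *m adj V' by [].
rewrite VJ V1E rdiag_split.
have -> : rdiag F (fun i => (r2 <= lshift r1 i)%N%:R) = 0 :> 'M[K]_r2.
  by rewrite -rdiag0; apply: eq_rdiag => i /=; rewrite leqNgt ltn_ord.
have -> : rdiag F (fun i => (r2 <= rshift r2 i)%N%:R) = 1%:M :> 'M[K]_r1.
  by rewrite -rdiag1; apply: eq_rdiag => i /=; rewrite leq_addr.
rewrite mul_row_block !mulmx0 addr0 add0r mulmx1 adj_row_mx mul_row_col.
by rewrite mul0mx add0r.
Qed.

(** P Q is the projection onto the intersection, hence onto a span of right
    singular vectors, so it is diagonal in the same basis as S.  As P is
    absorbed by S, Q commutes with S too. *)
Lemma spanned_gram_invariant m n k (A : 'M[K]_(m, n)) (B : 'M[K]_(n, k)) :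
  cproj (adj A) *m cproj B = cproj B *m cproj (adj A) ->
  spanned_by_right_singular_vectors A (colspace (adj A) :&: colspace B)%MS ->
  gram_invariant A B.
Proof.
move=> comm [U [s [V [[svdA _] [J _ hJ]]]]].
have [_ [oV _]] := unordered_svd_unitary svdA.
have : (colspace (cproj (adj A) *m cproj B) ==
        colspace (V *m set_ind J *m adj V))%MS.
  apply/eqmxP; apply: eqmx_trans (eqmxP (colspace_cap comm)) _.
  apply: eqmx_trans (eqmxP hJ) _.
  exact/eqmx_sym/eqmxP/colspace_sum_cols.
have oVJ := orthogonal_projection_set_ind J oV.
move/colspace_eqP; rewrite (cproj_id oVJ) cproj_id => [PE|]; last first.
  by apply: orthogonal_projectionM => //; exact: orthogonal_projection_cproj.
have := conj_rdiag_commute (fun j => (j \in J)%:R) (fun j => s`_j ^+ 2) oV.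
rewrite -(unordered_svd_gram svdA) -PE {1}comm -!mulmxA (mulmxA (cproj (adj
  A))) cproj_mul.
by rewrite /gram_invariant => ->; rewrite !mulmxA -(mulmxA _ A) mul_cproj_adj.
Qed.

End Spanned.

(** * Principal angles *)

Section PrincipalAngles.
Variables (R : realType) (F : scalars).
Local Notation K := (scalar_field R F).

Lemma cos_eq01 (theta : R) : 0 <= theta <= pi / 2 ->
  (cos theta = 0 \/ cos theta = 1) <-> (theta = 0 \/ theta = pi / 2).
Proof.
move=> /andP[t0 tpi2].
have tpi : theta \in `[0, pi].
  by rewrite in_itv /= t0 (le_trans tpi2)// ler_pdivrMr// ler_peMr ?pi_ge0//
    ler1n.
split=> [[c0|c1]|[->|->]].
- by right; rewrite -(cosK tpi) c0 acos0.
- by left; rewrite -(cosK tpi) c1 acos1.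
- by right; exact: cos0.
- by left; exact: cos_pihalf.
Qed.

Lemma acos_pihalf (x : R) : 0 <= x <= 1 ->
  0 <= acos x <= pi / 2 /\ cos (acos x) = x.
Proof.
move=> /andP[x0 x1].
have x11 : -1 <= x <= 1 by rewrite x1 (le_trans _ x0)// lerN10.
have [/andP[a0 api] ca] := acos_def x11; split => //; rewrite a0 /=.
rewrite leNgt; apply/negP => h.
have : cos (acos x) < cos (pi / 2).
  rewrite ltr_cos// in_itv/= ?a0//.
  by rewrite divr_ge0 ?pi_ge0// ler_pdivrMr// ler_peMr ?pi_ge0// ler1n.
by rewrite cos_pihalf ca ltNge x0.
Qed.

(** The equation makes every singular value a root of x^3 = x. *)
Lemma unordered_svd_partial_isometry p q (M : 'M[K]_(p, q)) U s V :
  unordered_svd M U s V -> M *m adj M *m M = M ->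
  forall i, (i < minn p q)%N -> s`_i = 0 \/ s`_i = 1.
Proof.
move=> svdM MMM i; rewrite leq_min => /andP[ip iq].
have [_ [vV _]] := unordered_svd_unitary svdM.
have /matrixP /(_ (Ordinal ip) (Ordinal iq)) :
    msigma F p q s *m rdiag F (fun j => s`_j ^+ 2) = msigma F p q s.
  rewrite -(unordered_svd_msigma svdM).
  have := unordered_svd_gram svdM => /(congr1 (fun X => X *m V)).
  rewrite -[X in _ = X -> _]mulmxA vV mulmx1 => e.
  rewrite -[LHS]mulmxA -e -!(mulmxA (adj U)); congr (_ *m _).
  by rewrite !mulmxA MMM.
rewrite mul_mx_diag !mxE /= eqxx -rmorphM => /fmorph_inj e.
have s0 : 0 <= s`_i.
  have [is_|?] := ltnP i (size s); last by rewrite nth_default.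
  by case: svdM => _ _ _ _ /allP s0; rewrite ltW// s0// mem_nth.
have [->|nz] := eqVneq s`_i 0; [by left|right].
move: e; rewrite -[RHS]mulr1 => /(mulfI nz) /eqP.
by rewrite sqrf_eq1 => /orP[/eqP//|/eqP e]; move: s0; rewrite e lerNr oppr0
  ler10.
Qed.

(** For the i-th right singular vector y, 1 - s_i^2 is the squared length of
    the part of U y that the projection V adj V removes. *)
Lemma singular_value_le1 n p q r (U : 'M[K]_(n, p)) (V : 'M[K]_(n, q)) X s Y :
  orthonormal_cols U -> orthonormal_cols V ->
  @csvd R F q p r (adj V *m U) X s Y ->
  forall i, (i < r)%N -> s`_i <= 1.
Proof.
move=> oU oV [oX oY hW hs s0] i ir; pose Z := (1%:M - V *m adj V) *m U *m Y.
have YWWY : adj Y *m (adj (adj V *m U) *m (adj V *m U)) *m Y =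
    kdiag F r s *m kdiag F r s.
  rewrite hW !adjM adj_msigma adjK !mulmxA oY mul1mx -(mulmxA _ (adj X)) oX
    mulmx1.
  by rewrite -(mulmxA _ (adj Y)) oY mulmx1.
have [PP aP] : orthogonal_projection (1%:M - V *m adj V).
  rewrite -orthonormal_cproj//.
  exact/orthogonal_projection_compl/orthogonal_projection_cproj.
have ZZ : adj Z *m Z = 1%:M - kdiag F r s *m kdiag F r s.
  rewrite /Z; move: PP aP; set P := 1%:M - _ => PP aP.
  rewrite !adjM aP !mulmxA -(mulmxA _ P P) PP /P mulmxBr mulmx1 !mulmxBl.
  by rewrite -YWWY adjM adjK -!mulmxA (mulmxA (adj U) U) oU mul1mx oY.
have : 0 <= (adj Z *m Z) (Ordinal ir) (Ordinal ir).
  by rewrite mxE; apply: sumr_ge0 => k _; rewrite !mxE mulrC; exact: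
    mul_kconj_ge0.
rewrite ZZ !kdiagE mul_diag_mx !mxE eqxx !mulr1n -rmorphM -(rmorph1 (@kreal R
  F)) -rmorphB.
rewrite kreal_ge0 subr_ge0 -expr2 /= expr_le1//.
by move/allP: s0 => s0; rewrite ltW// s0// mem_nth// hs.
Qed.

(** For orthonormal bases U and V of the two spaces, all angles are 0 or a
    right angle if and only if all singular values of W = adj V *m U are 0 or
    1, which is W adj W W = W; multiplied by V and adj U this is an identity
    between the two projections. *)
Lemma principal_angles_commute n m1 m2 (M : 'M[K]_(n, m1)) (N : 'M[K]_(n, m2)) :
  principal_angles_0_pi2 M N <-> cproj M *m cproj N = cproj N *m cproj M.
Proof.
split=> [h|comm theta [p [q [U [V [oU oV /colspace_eqP UM /colspace_eqP
  VN]]]]]].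
  have [p [U [oU UM]]] := cproj_factor M.
  have [q [V [oV VN]]] := cproj_factor N.
  have [r [X0 [s0 [Y0 /csvd_sort[g [s [hW ss]]]]]]] := csvd_exists (adj V *m U).
  have [X [Y svdW]] := csvd_unordered_svd hW.
  have rW := csvd_rank hW.
  have s1 i : (i < r)%N -> s`_i = 1.
    move=> ir; have si1 := singular_value_le1 oU oV hW ir.
    have si0 : 0 < s`_i by case: hW => _ _ _ hs /allP; apply; rewrite mem_nth
      ?hs.
    have [|a0 ca] := @acos_pihalf s`_i; first by rewrite (ltW si0).
    have : acos s`_i = 0 \/ acos s`_i = pi / 2.
      apply: h; exists p, q, U, V; split=> //.
      - by apply/colspace_eqP; rewrite orthonormal_cproj.
      - by apply/colspace_eqP; rewrite orthonormal_cproj.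
      exists X, s, Y, i; split=> //.
      by rewrite leq_min !(leq_trans ir)// -rW ?rank_leq_row ?rank_leq_col.
    by move/(cos_eq01 a0); rewrite ca => -[e|//]; rewrite e ltxx in si0.
  have k1 : kdiag F r s = 1%:M.
    by rewrite kdiagE -rdiag1; apply: eq_rdiag => i; rewrite s1.
  have WWW : adj V *m U *m (adj U *m V) *m (adj V *m U) = adj V *m U.
    have [oX oY hW' _ _] := hW; rewrite -[V in adj U *m V]adjK -adjM hW' k1
      mulmx1.
    by rewrite adjM adjK -!mulmxA (mulmxA (adj _)) oY mul1mx (mulmxA (adj _))
      oX mul1mx.
  apply/esym; apply: orthogonal_projection_commute; try exact:
    orthogonal_projection_cproj.
  rewrite UM VN; have := congr1 (fun Z => V *m Z *m adj U *m (V *m adj V)) WWW.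
  by rewrite !mulmxA.
case=> X [s [Y [i [[svdW _] ipq th ct]]]].
apply/(cos_eq01 th); rewrite ct.
apply: (unordered_svd_partial_isometry svdW); last by rewrite minnC.
move: comm; rewrite -UM -VN !orthonormal_cproj// => comm.
have -> : adj V *m U *m adj (adj V *m U) *m (adj V *m U) =
    adj V *m (U *m adj U *m (V *m adj V)) *m U.
  by rewrite adjM adjK !mulmxA.
by rewrite comm !mulmxA oV mul1mx -!mulmxA oU mulmx1.
Qed.

End PrincipalAngles.

(** * Adjoints exchange the two lists *)

Section Duality.
Variables (R : realType) (F : scalars).
Local Notation K := (scalar_field R F).

Lemma rank_adj m n (M : 'M[K]_(m, n)) : \rank (adj M) = \rank M.
Proof. by rewrite /adj mxrank_map mxrank_tr. Qed.

Lemma unordered_svd_adj p q (M : 'M[K]_(p, q)) U s V :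
  unordered_svd M U s V -> unordered_svd (adj M) V s U.
Proof.
case=> uU uV eM hs s0; split=> //; last by rewrite rank_adj.
by rewrite eM !adjM adjK -/(msigma F p q s) adj_msigma mulmxA.
Qed.

Lemma svd_adj p q (M : 'M[K]_(p, q)) U s V : svd M U s V -> svd (adj M) V s U.
Proof. by case=> /unordered_svd_adj h ss; split. Qed.

Lemma unitary_adj n (U : 'M[K]_n) : unitary U -> unitary (adj U).
Proof. by case=> h1 h2; split; rewrite adjK. Qed.

Lemma orthogonal_projection_adj n (P : 'M[K]_n) :
  orthogonal_projection (adj P) <-> orthogonal_projection P.
Proof.
suff H (Q : 'M[K]_n) : orthogonal_projection Q -> orthogonal_projection (adj Q).
  by split=> [/H|/H]//; rewrite adjK.
by case=> h1 h2; split; rewrite -?adjM ?h1 ?h2.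
Qed.

Lemma inverse124_adj m n (M : 'M[K]_(m, n)) (X : 'M[K]_(n, m)) :
  inverse124 M X <-> inverse123 (adj M) (adj X).
Proof.
rewrite /inverse124 /inverse123 /penrose1 /penrose2 /penrose3 /penrose4.
rewrite -!adjM !mulmxA; split=> -[h1 h2 h3]; split.
- by rewrite h1.
- by rewrite h2.
- by rewrite h3.
- exact: adjmx_inj h1.
- exact: adjmx_inj h2.
- exact: adjmx_inj h3.
Qed.

Lemma adj_castmx m n m' n' (e1 : m = m') (e2 : n = n') (M : 'M[K]_(m, n)) :
  adj (castmx (e1, e2) M) = castmx (e2, e1) (adj M).
Proof. by case: m' / e1; case: n' / e2; rewrite !castmx_id. Qed.

Lemma block_row_form_adj n r (Q : 'M[K]_r) (W : 'M[K]_n) :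
  block_row_form Q W <-> block_column_form (adj Q) (adj W).
Proof.
split=> -[p [q [c [X [Y [hr [hc eW]]]]]]].
  exists p, q, c, (adj X), (adj Y), hc, hr.
  by rewrite eW adj_castmx !(adj_col_mx, adj_row_mx) !adjmx0 -block_mxEh
    /block_mx -block_mxEh.
exists p, q, c, (adj X), (adj Y), hc, hr.
rewrite -[W]adjK eW adj_castmx !(adj_col_mx, adj_row_mx) !adjmx0 adjK.
by rewrite -block_mxEh /block_mx -block_mxEh.
Qed.

Lemma spanned_by_left_adj p q (M : 'M[K]_(p, q)) (W : 'M[K]_p) :
  spanned_by_left_singular_vectors M W <->
  spanned_by_right_singular_vectors (adj M) W.
Proof.
split=> -[U [s [V [h sp]]]]; exists V, s, U; split.
- exact: svd_adj.
- by rewrite rank_adj.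
- by rewrite -[M]adjK; exact: svd_adj.
- by rewrite -rank_adj.
Qed.

End Duality.

(** * The conditions of the first list *)

Section Conditions.
Variables (R : realType) (F : scalars).
Local Notation K := (scalar_field R F).
Lemma projectionP m n k (A : 'M[K]_(m, n)) (B : 'M[K]_(n, k)) :
  orthogonal_projection (A *m B *m mpinv B *m mpinv A) <-> gram_invariant A B.
Proof.
split=> [|h]; first exact: projection_gram_invariant.
rewrite -[X in orthogonal_projection X]mulmxA.
exact/inverse123_projection/gram_invariant_inverse123.
Qed.

Lemma inverse123P m n k (A : 'M[K]_(m, n)) (B : 'M[K]_(n, k)) :
  inverse123 (A *m B) (mpinv B *m mpinv A) <-> gram_invariant A B.
Proof.
split=> [/inverse123_projection|]; last exact: gram_invariant_inverse123.
by rewrite mulmxA => /projectionP.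
Qed.

(** (A B)(A B)^+ is an orthogonal projection; conversely, M X is the
    projection onto the column space of M for every {1,2,3}-inverse X. *)
Lemma mpinv_projectionP m n k (A : 'M[K]_(m, n)) (B : 'M[K]_(n, k)) :
  A *m B *m mpinv B *m mpinv A = A *m B *m mpinv (A *m B)
  <-> gram_invariant A B.
Proof.
split=> [e|/inverse123P/inverse123_mpinv]; last by rewrite mulmxA.
apply/projectionP; rewrite e -cprojE; exact: orthogonal_projection_cproj.
Qed.

(** If A B = 0, then S Q = 0, and so is its adjoint Q S. *)
Lemma svd_blockP m n k r (A : 'M[K]_(m, n)) (B : 'M[K]_(n, k)) :
  \rank B = r ->
  (exists UA sA VA UB sB VB (Q : 'M[K]_r),
     [/\ unordered_svd A UA sA VA, unordered_svd B UB sB VB,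
         unitary Q & block_column_form Q (adj VA *m UB)])
  \/ A *m B = 0 <-> gram_invariant A B.
Proof.
move=> hr; split=> [[/(unordered_svd_block _ hr)//|AB0]|h]; last first.
  by left; apply/unordered_svd_block.
have SB : adj A *m A *m cproj B = 0 by rewrite cprojE mulmxA -(mulmxA _ A) AB0
  mulmx0 mul0mx.
rewrite /gram_invariant SB; apply: adjmx_inj; rewrite adjmx0 !adjM adjK
  adj_cproj.
exact: SB.
Qed.

Lemma inverse123_gramP m n k (A : 'M[K]_(m, n)) (B : 'M[K]_(n, k)) :
  inverse123 (adj A *m A *m B *m adj B)
    (mpinv (B *m adj B) *m mpinv (adj A *m A)) <-> gram_invariant A B.
Proof. by rewrite -gram_invariant_gram -[X in inverse123 X _]mulmxA; exact:
  inverse123P. Qed.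

Lemma singular_vectorsP m n k (A : 'M[K]_(m, n)) (B : 'M[K]_(n, k)) :
  principal_angles_0_pi2 (adj A) B /\
    spanned_by_right_singular_vectors A (colspace (adj A) :&: colspace B)%MS
  <-> gram_invariant A B.
Proof.
split=> [[/principal_angles_commute] |h]; first exact: spanned_gram_invariant.
split; last exact: gram_invariant_spanned.
exact/principal_angles_commute/gram_invariant_commute.
Qed.

Lemma spanned_by_right_eqmx p q (M : 'M[K]_(p, q)) (W W' : 'M[K]_q) :
  (W :=: W')%MS -> spanned_by_right_singular_vectors M W ->
  spanned_by_right_singular_vectors M W'.
Proof.
move=> eW [U [s [V [h [J Jr WJ]]]]]; exists U, s, V; split=> //; exists J => //.
by apply/eqmxP; apply: eqmx_trans (eqmx_sym eW) (eqmxP WJ).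
Qed.

End Conditions.

(** * The conditions of the second list *)

Section Dual.
Variables (R : realType) (F : scalars).
Local Notation K := (scalar_field R F).

Lemma inverse124P m n k (A : 'M[K]_(m, n)) (B : 'M[K]_(n, k)) :
  inverse124 (A *m B) (mpinv B *m mpinv A)
  <-> gram_invariant (adj B) (adj A).
Proof. by rewrite inverse124_adj !adjM -!mpinv_adj; exact: inverse123P. Qed.

Lemma dual_colspace m n k (A : 'M[K]_(m, n)) (B : 'M[K]_(n, k)) :
  (colspace (B *m adj B *m adj A) == colspace (adj A) :&: colspace B)%MS
  <-> gram_invariant (adj B) (adj A).
Proof.
rewrite gram_invariant_colspace !adjK.
by split=> /eqmxP h; apply/eqmxP; apply: eqmx_trans h _; rewrite capmxC.
Qed.

Lemma dual_projectionP m n k (A : 'M[K]_(m, n)) (B : 'M[K]_(n, k)) :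
  orthogonal_projection (mpinv B *m mpinv A *m A *m B)
  <-> gram_invariant (adj B) (adj A).
Proof.
by rewrite -orthogonal_projection_adj !adjM -!mpinv_adj !mulmxA; exact:
  projectionP.
Qed.

Lemma dual_mpinv_projectionP m n k (A : 'M[K]_(m, n)) (B : 'M[K]_(n, k)) :
  mpinv B *m mpinv A *m A *m B = mpinv (A *m B) *m (A *m B)
  <-> gram_invariant (adj B) (adj A).
Proof.
rewrite -mpinv_projectionP -adjM !mpinv_adj -!adjM !mulmxA.
by split=> [->|/adjmx_inj].
Qed.

Lemma dual_svd_blockP m n k r (A : 'M[K]_(m, n)) (B : 'M[K]_(n, k)) :
  \rank A = r ->
  (exists UA sA VA UB sB VB (Q : 'M[K]_r),
     [/\ unordered_svd A UA sA VA, unordered_svd B UB sB VB,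
         unitary Q & block_row_form Q (adj VA *m UB)])
  \/ A *m B = 0
  <-> gram_invariant (adj B) (adj A).
Proof.
rewrite -rank_adj => hr; rewrite -(svd_blockP (adj B) hr) -adjM.
split=> -[[UA [sA [VA [UB [sB [VB [Q [svdA svdB uQ bQ]]]]]]]]|AB0].
- left; exists VB, sB, UB, VA, sA, UA, (adj Q); split.
  + exact: unordered_svd_adj.
  + exact: unordered_svd_adj.
  + exact: unitary_adj.
  + by move/block_row_form_adj: bQ; rewrite adjM adjK.
- by right; rewrite AB0 adjmx0.
- left; exists VB, sB, UB, VA, sA, UA, (adj Q); split.
  + by rewrite -[A]adjK; exact: unordered_svd_adj.
  + by rewrite -[B]adjK; exact: unordered_svd_adj.
  + exact: unitary_adj.
  + by apply/block_row_form_adj; rewrite adjM !adjK.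
- by right; apply: adjmx_inj; rewrite AB0 adjmx0.
Qed.

Lemma inverse124_gramP m n k (A : 'M[K]_(m, n)) (B : 'M[K]_(n, k)) :
  inverse124 (adj A *m A *m B *m adj B)
    (mpinv (B *m adj B) *m mpinv (adj A *m A))
  <-> gram_invariant (adj B) (adj A).
Proof.
rewrite inverse124_adj -inverse123_gramP !adjM -!mpinv_adj !adjM !adjK.
by rewrite !mulmxA.
Qed.

Lemma left_singular_vectorsP m n k (A : 'M[K]_(m, n)) (B : 'M[K]_(n, k)) :
  principal_angles_0_pi2 (adj A) B /\
    spanned_by_left_singular_vectors B (colspace (adj A) :&: colspace B)%MS
  <-> gram_invariant (adj B) (adj A).
Proof.
rewrite -singular_vectorsP !adjK spanned_by_left_adj.
have cap : (colspace (adj A) :&: colspace B :=: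
    colspace B :&: colspace (adj A))%MS.
  by rewrite capmxC.
split=> -[/principal_angles_commute/esym/principal_angles_commute pa sp];
  split=> //.
- exact: spanned_by_right_eqmx sp.
- by apply: spanned_by_right_eqmx sp; exact: eqmx_sym.
Qed.

End Dual.

(** * The two lists of equivalent conditions *)

Theorem theorem9p11 (R : realType) (F : scalars) (m n k rA rB : nat)
    (A : 'M[scalar_field R F]_(m, n)) (B : 'M[scalar_field R F]_(n, k))
    (hA : \rank A = rA) (hB : \rank B = rB) :
  ([<-> inverse123 (A *m B) (mpinv B *m mpinv A);
        (colspace (adj A *m A *m B) == colspace (adj A) :&: colspace B)%MS;
        orthogonal_projection (A *m B *m mpinv B *m mpinv A);
        A *m B *m mpinv B *m mpinv A = A *m B *m mpinv (A *m B);
        (exists UA sA VA UB sB VB (Q : 'M[scalar_field R F]_rB),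
           [/\ unordered_svd A UA sA VA, unordered_svd B UB sB VB,
               unitary Q & block_column_form Q (adj VA *m UB)])
        \/ A *m B = 0;
        inverse123 (adj A *m A *m B *m adj B)
          (mpinv (B *m adj B) *m mpinv (adj A *m A));
        principal_angles_0_pi2 (adj A) B /\
        spanned_by_right_singular_vectors A
          (colspace (adj A) :&: colspace B)%MS])
  /\
  ([<-> inverse124 (A *m B) (mpinv B *m mpinv A);
        (colspace (B *m adj B *m adj A) == colspace (adj A) :&: colspace B)%MS;
        orthogonal_projection (mpinv B *m mpinv A *m A *m B);
        mpinv B *m mpinv A *m A *m B = mpinv (A *m B) *m (A *m B);
        (exists UA sA VA UB sB VB (Q : 'M[scalar_field R F]_rA),
           [/\ unordered_svd A UA sA VA, unordered_svd B UB sB VB,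
               unitary Q & block_row_form Q (adj VA *m UB)])
        \/ A *m B = 0;
        inverse124 (adj A *m A *m B *m adj B)
          (mpinv (B *m adj B) *m mpinv (adj A *m A));
        principal_angles_0_pi2 (adj A) B /\
        spanned_by_left_singular_vectors B
          (colspace (adj A) :&: colspace B)%MS]).
Proof.
split.
- have e1 := inverse123P A B; have e2 := gram_invariant_colspace A B.
  have e3 := projectionP A B; have e4 := mpinv_projectionP A B.
  have e5 := svd_blockP A hB; have e6 := inverse123_gramP A B.
  have e7 := singular_vectorsP A B.
  tfae.
  + by move/e1/e2.
  + by move/e2/e3.
  + by move/e3/e4.
  + by move/e4/e5.
  + by move/e5/e6.
  + by move/e6/e7.
  + by move/e7/e1.
- have e1 := inverse124P A B; have e2 := dual_colspace A B.
  have e3 := dual_projectionP A B; have e4 := dual_mpinv_projectionP A B.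
  have e5 := dual_svd_blockP B hA; have e6 := inverse124_gramP A B.
  have e7 := left_singular_vectorsP A B.
  tfae.
  + by move/e1/e2.
  + by move/e2/e3.
  + by move/e3/e4.
  + by move/e4/e5.
  + by move/e5/e6.
  + by move/e6/e7.
  + by move/e7/e1.
Qed.
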